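(* Let $p\ge2$, $1\le q\le\infty$, $2\le s\le p$, and $R>0$. Consider the model $y=X\theta+\xi$, $Z=X+W$ with $y,\xi\in\mathbb{R}^n$, $X,Z,W$ being $n\times p$ matrices and $\theta\in\mathbb{R}^p$, where the elements of the triplet $(\xi,X,W)$ are jointly independent, the components of $\xi$ and of $W$ are i.i.d. zero-mean Gaussian random variables with positive variances $\sigma^2$ and $\sigma_*^2$ respectively, and the rows of $X$ are i.i.d. zero-mean Gaussian random vectors with positive definite covariance matrix $\Sigma$. Assume that $s\log(p/s)/n\le\bar c\,R^2/(R^2+1)$ for some constant $\bar c>0$. Then there exist constants $c>0$ and $c'>0$, depending only on $q,\sigma^2,\sigma_*^2,\bar c,\lambda_{\min}^\Sigma$ and $\lambda_{\max}^\Sigma$, such that $$\inf_{\hat T}\ \sup_{\theta\in B_0(s)\cap S_2(R)}\mathbb{P}_{X,\theta}\Big[|\hat T-\theta|_q\ge c\,s^{1/q}\sqrt{\frac{\log(p/s)}{n}}\,(R+1)\Big]>c',$$ where $\inf_{\hat T}$ denotes the infimum over all estimators, i.e. measurable functions of $(y,Z)$ with values in $\mathbb{R}^p$, and $s^{1/\infty}=1$.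
   Context: $|\cdot|_q$ is the $\ell_q$-norm on $\mathbb{R}^p$ and $|\theta|_0$ the number of nonzero components of $\theta$. $B_0(s)=\{\theta\in\mathbb{R}^p:|\theta|_0\le s\}$, $S_2(R)=\{\theta\in\mathbb{R}^p:|\theta|_2=R\}$. $\mathbb{P}_{X,\theta}$ is the probability measure of the observed pair $(y,Z)$ when the parameter is $\theta$ ($X$ being random with the stated Gaussian distribution and unobserved). $\lambda_{\min}^\Sigma$ and $\lambda_{\max}^\Sigma$ are the smallest and largest eigenvalues of $\Sigma$. *)

(* Defs.v *)
From HB Require Import structures.
From mathcomp Require Import all_boot all_order all_algebra.
From mathcomp Require Import all_classical all_reals all_analysis.

Set Implicit Arguments.
Unset Strict Implicit.
Unset Printing Implicit Defensive.

Import Order.TTheory GRing.Theory Num.Theory.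

Local Open Scope classical_set_scope.
Local Open Scope ring_scope.

(* Matrices carry the product sigma-algebra, i.e. the one generated by the
   entries; over R this is the Borel sigma-algebra. *)
Definition matrix_display : measure_display -> measure_display.
Proof. exact. Qed.

Section measurable_matrix.
Context {d} {T : measurableType d}.
Variables m n : nat.

Definition mx_cylinders : set (set 'M[T]_(m, n)) :=
  [set A | exists (i : 'I_m) (j : 'I_n), exists2 B : set T,
    measurable B & A = [set M : 'M[T]_(m, n) | B (M i j)]].

Let mx_measurable : set (set 'M[T]_(m, n)) := <<s mx_cylinders >>.

Let mx_set0 : mx_measurable set0.
Proof. exact: sigma_algebra0. Qed.

Let mx_setC A : mx_measurable A -> mx_measurable (~` A).
Proof. exact: sigma_algebraC. Qed.

Let mx_bigcup (F : (set 'M[T]_(m, n))^nat) :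
  (forall i, mx_measurable (F i)) -> mx_measurable (\bigcup_i F i).
Proof. exact: sigma_algebra_bigcup. Qed.

HB.instance Definition _ := @isMeasurable.Build (matrix_display d)
  'M[T]_(m, n) mx_measurable mx_set0 mx_setC mx_bigcup.

End measurable_matrix.

Lemma measurable_fun_mxP d d' (aT : measurableType d) (T : measurableType d')
    (m n : nat) (f : aT -> 'M[T]_(m, n)) :
  measurable_fun [set: aT] f <->
  forall i j, measurable_fun [set: aT] (fun w => f w i j).
Proof.
split=> [mf i j _ B mB|mf].
  rewrite setTI; have -> : (fun w => f w i j) @^-1` B =
      [set: aT] `&` f @^-1` [set M : 'M[T]_(m, n) | B (M i j)] by rewrite setTI.
  apply: mf => //; apply: sub_sigma_algebra.
  by exists i, j, B.
move=> _ A mA; rewrite setTI.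
have : <<s @mx_cylinders _ T m n >> A by [].
move: A {mA}; apply: smallest_sub; last first.
  move=> _ [i [j [B mB ->]]] /=.
  by have := mf i j measurableT B mB; rewrite setTI.
split=> [|A mA|F mF] /=.
- by rewrite preimage_set0.
- by rewrite setTD preimage_setC; exact: measurableC.
- by rewrite preimage_bigcup; exact: bigcup_measurable.
Qed.

Section vectors.
Context {R : realType} {p : nat}.
Implicit Types (q : \bar R) (x : 'cV[R]_p).

(* Meant for 1 <= q <= +oo; the value at -oo is junk. *)
Definition lq_norm q x : R :=
  match q with
  | r%:E => (\sum_i `|x i 0| `^ r) `^ r^-1
  | +oo%E => \big[Num.max/0]_i `|x i 0|
  | -oo%E => 0
  end.

(* 1/q, with 1/oo = 0. *)
Definition inv_exponent q : R := if q is r%:E then r^-1 else 0.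

Definition l0_norm x : nat := #|[set i | x i 0 != 0]%SET|.

Definition sparse_ball (s : nat) : set 'cV[R]_p :=
  [set x | (l0_norm x <= s)%N].

Definition l2_sphere (r : R) : set 'cV[R]_p := [set x | lq_norm 2%:E x = r].

Definition positive_definite (S : 'M[R]_p) : Prop :=
  S^T = S /\ forall v : 'rV[R]_p, v != 0 -> 0 < (v *m S *m v^T) 0 0.

Definition smallest_eigenvalue (S : 'M[R]_p) (a : R) : Prop :=
  eigenvalue S a /\ forall b, eigenvalue S b -> a <= b.

Definition largest_eigenvalue (S : 'M[R]_p) (a : R) : Prop :=
  eigenvalue S a /\ forall b, eigenvalue S b -> b <= a.

End vectors.

Section gaussian.
Context d {Omega : measurableType d} {R : realType} (P : probability Omega R).

(* Taking some of the A i to be the whole space yields the product rule for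
   every subfamily. *)
Definition mutually_independent d' (T : measurableType d') (I : finType)
    (X : I -> Omega -> T) : Prop :=
  forall A : I -> set T, (forall i, measurable (A i)) ->
    P (\bigcap_i (X i @^-1` A i)) = (\prod_i P (X i @^-1` A i))%E.

Definition independent_triplet d1 d2 d3 (T1 : measurableType d1)
    (T2 : measurableType d2) (T3 : measurableType d3)
    (X1 : Omega -> T1) (X2 : Omega -> T2) (X3 : Omega -> T3) : Prop :=
  forall A1 A2 A3, measurable A1 -> measurable A2 -> measurable A3 ->
    P (X1 @^-1` A1 `&` X2 @^-1` A2 `&` X3 @^-1` A3) =
    (P (X1 @^-1` A1) * P (X2 @^-1` A2) * P (X3 @^-1` A3))%E.

(* s is the standard deviation. *)
Definition centered_gaussian (s : R) (X : Omega -> R) : Prop :=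
  measurable_fun [set: Omega] X /\
  forall B, measurable B -> P (X @^-1` B) = normal_prob 0 s B.

Definition iid_centered_gaussian (I : finType) (s : R) (X : I -> Omega -> R) :
    Prop :=
  mutually_independent X /\ forall i, centered_gaussian s (X i).

(* V ~ N(0, S): V is a linear image of a standard Gaussian vector, with
   covariance matrix S. Requiring G to live on the same space as V is no
   restriction when S is positive definite: A is then invertible. *)
Definition gaussian_vector p (S : 'M[R]_p) (V : Omega -> 'rV[R]_p) : Prop :=
  exists (A : 'M[R]_p) (G : Omega -> 'rV[R]_p),
    [/\ A^T *m A = S,
        iid_centered_gaussian 1 (fun j w => G w 0 j) &
        forall w, V w = G w *m A].

Definition errors_in_variables n p (sigma sigmas : R) (Sigma : 'M[R]_p)
    (xi : Omega -> 'cV[R]_n) (X W : Omega -> 'M[R]_(n, p)) : Prop :=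
  [/\ independent_triplet xi X W,
      iid_centered_gaussian sigma (fun i w => xi w i 0),
      iid_centered_gaussian sigmas
        (fun (ij : 'I_n * 'I_p) w => W w ij.1 ij.2),
      mutually_independent (fun i w => row i (X w)) &
      forall i, gaussian_vector Sigma (fun w => row i (X w))].

(* The observed pair (y, Z) = (X theta + xi, X + W). *)
Definition observation n p (xi : Omega -> 'cV[R]_n)
    (X W : Omega -> 'M[R]_(n, p)) (theta : 'cV[R]_p) (w : Omega) :
    'cV[R]_n * 'M[R]_(n, p) :=
  (X w *m theta + xi w, X w + W w).

Definition observation_law n p (xi : Omega -> 'cV[R]_n)
    (X W : Omega -> 'M[R]_(n, p)) (theta : 'cV[R]_p) :
    set ('cV[R]_n * 'M[R]_(n, p)) -> \bar R :=
  pushforward P (observation xi X W theta).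

End gaussian.

Definition estimators {R : realType} (n p : nat) :
    set ('cV[R]_n * 'M[R]_(n, p) -> 'cV[R]_p) :=
  [set T | measurable_fun [set: 'cV[R]_n * 'M[R]_(n, p)] T].

Arguments estimators {R} n p.

(* Main.v *)
Require Import Defs.
From HB Require Import structures.
From mathcomp Require Import all_boot all_order all_algebra.
From mathcomp Require Import all_classical all_reals all_analysis.
From mathcomp Require Import measurable_realfun zify ring lra.

Set Implicit Arguments.
Unset Strict Implicit.
Unset Printing Implicit Defensive.

Import Order.TTheory GRing.Theory Num.Theory.
Import numFieldNormedType.Exports.

Local Open Scope classical_set_scope.
Local Open Scope ring_scope.

(* Write a sparse parameter as theta = t e_0 + delta (one unit vector in each of
   m blocks of N coordinates), with delta of order
   sqrt(log(p/s)/n) (R + 1) and t^2 = R^2 - m delta^2 >= R^2 / 2. A wrong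
   decision in a fixed fraction of the blocks costs the announced lq error, so
   it suffices that, in each block, the N positions cannot be told apart.

   Moving one coordinate k of theta by delta changes y by h = delta X e_k. The
   same change of (y, Z) is produced either by shifting the noise xi by h (used
   for R <= 1) or by shifting the first column of X by h / t and that of W by
   - h / t (used for R > 1): the fluctuation of X not visible in Z acts as an
   additional noise of size R. In terms of a standard Gaussian matrix M this is a
   transvection M_i |-> M_i + (M_i . b_i) c_i with b_i orthogonal to c_i, whose
   density has second moment at most exp(2 n |b|^2 |c|^2) <= sqrt N, because
   |b|^2 |c|^2 is of order delta^2 / (R + 1)^2. Since
   L 1_A <= L^2 / (2 kappa) + kappa 1_A / 2, the probability of a correct decision
   averaged over the N positions stays below 17/20, and Markov's inequality for
   the number of correct blocks concludes.

   Transvections are products of elementary ones (a pivot of c_i plays the role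
   of an elimination step), and for an elementary one the density formula is
   Fubini's theorem and the translation formula for N(0, 1). *)

(** * Gaussian measures on the line *)

Section density.
Context d (T : measurableType d) (R : realType).
Variables (mu nu : {measure set T -> \bar R}) (h : T -> R).
Hypothesis mh : measurable_fun setT h.
Hypothesis h0 : forall x, 0 <= h x.
Hypothesis nuE : forall A, measurable A -> nu A = (\int[mu]_(x in A) (h x)%:E)%E.

Import HBNNSimple.

Let integral_density_nnsfun (g : {nnsfun T >-> R}) :
  (\int[nu]_x (g x)%:E = \int[mu]_x (g x * h x)%:E)%E.
Proof.
have nn r x : (0 <= (r * \1_(g @^-1` [set r]) x)%:E)%E.
  by rewrite EFinM nnfun_muleindic_ge0.
under eq_integral do rewrite fimfunE -fsumEFin//.
rewrite ge0_integral_fsum//; last first.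
  by move=> r; exact/measurable_EFinP/measurableT_comp.
under [RHS]eq_integral.
  move=> x _; rewrite fimfunE EFinM -fsumEFin// ge0_mule_fsuml//.
  over.
rewrite ge0_integral_fsum//; last 2 first.
  - move=> r; apply: emeasurable_funM; last exact/measurable_EFinP.
    exact/measurable_EFinP/measurableT_comp.
  - by move=> n x _; rewrite mule_ge0 ?lee_fin// -lee_fin.
apply: eq_fsbigr => r _.
rewrite integralZl_indic_nnsfun//= integral_indic//= setIT nuE//.
under [RHS]eq_integral do rewrite EFinM -muleA.
have [r0|r0] := leP 0 r; last first.
  rewrite (_ : g @^-1` [set r] = set0); last first.
    by apply/seteqP; split=> // x /= gx; have : 0 <= g x by []; rewrite gx leNgt r0.
  rewrite integral_set0 mule0; under eq_integral do rewrite indic0 mul0e mule0.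
  by rewrite integral0.
rewrite ge0_integralZl//; last first.
- by move=> x _; rewrite mule_ge0 ?lee_fin.
- by apply: emeasurable_funM; exact/measurable_EFinP.
congr (_ * _)%E; rewrite integral_mkcond; apply: eq_integral => x _.
by rewrite epatch_indic/= muleC.
Qed.

(** Linearity gives the formula for simple functions; monotone convergence along [nnsfun_approx]
    extends it to nonnegative [f]. *)
Lemma ge0_integral_density (f : T -> R) :
  measurable_fun setT f -> (forall x, 0 <= f x) ->
  (\int[nu]_x (f x)%:E = \int[mu]_x (f x * h x)%:E)%E.
Proof.
move=> mf f0; have mf' : measurable_fun setT (EFin \o f) by exact/measurable_EFinP.
pose f_ := nnsfun_approx measurableT mf'.
transitivity (lim (\int[nu]_x (f_ n x)%:E @[n --> \oo])%E).
  rewrite -monotone_convergence//=.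
  - apply: eq_integral => ? /[!inE] xD; apply/esym/cvg_lim => //=.
    by apply: cvg_nnsfun_approx => // ? _; rewrite lee_fin.
  - by move=> n; exact/measurable_EFinP/measurable_funTS.
  - by move=> n ? _; rewrite lee_fin.
  - by move=> ? _ ? ? mn; rewrite lee_fin; exact/lefP/nd_nnsfun_approx.
under eq_fun do rewrite integral_density_nnsfun.
rewrite -monotone_convergence//=.
- apply: eq_integral => x /[!inE] xD; apply/cvg_lim => //=.
  rewrite EFinM; under eq_fun do rewrite EFinM; apply: cvgeZr => //.
  by apply: cvg_nnsfun_approx => // ? _; rewrite lee_fin.
- by move=> n; apply/measurable_EFinP/measurable_funM.
- by move=> n x _; rewrite lee_fin mulr_ge0.
- move=> x _ m n mn; rewrite lee_fin ler_wpM2r//.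
  exact/lefP/nd_nnsfun_approx.
Qed.

End density.

Section one_dimensional_gaussian.
Context {R : realType}.
Local Notation leb := (@lebesgue_measure R).
Local Notation gam := (normal_prob (0 : R) 1).

(** The pushforward of Lebesgue measure under x |-> a x + b, multiplied by a, gives every half-open
    interval its length, hence is Lebesgue measure by uniqueness. *)
Lemma ge0_integral_lebesgue_affine (a b : R) (f : R -> R) : 0 < a ->
  measurable_fun setT f -> (forall x, 0 <= f x) ->
  (\int[leb]_x (a * f (a * x + b))%:E = \int[leb]_x (f x)%:E)%E.
Proof.
move=> a0 mf f0.
have mg : measurable_fun setT ((fun x => a * x + b) : R -> measurableTypeR R).
  by apply: measurable_funD => //; exact: measurable_funM.
under eq_integral do rewrite EFinM.
have mfg : measurable_fun setT (fun x => (f (a * x + b))%:E).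
  by apply/measurable_EFinP; exact: (measurableT_comp mf mg).
rewrite ge0_integralZl ?lee_fin ?(ltW a0)//; last by move=> *; rewrite lee_fin.
pose nu_ : {measure set (measurableTypeR R) -> \bar R} :=
  mscale (NngNum (ltW a0)) (measure_function.pushforward leb (fun x => a * x + b : measurableTypeR R)).
pose nu := nu_ mg.
transitivity (\int[nu]_x (f x)%:E)%E.
  rewrite ge0_integral_mscale//=; last 2 first.
  - exact/measurable_EFinP.
  - by move=> *; rewrite lee_fin.
  rewrite ge0_integral_pushforward//=; first exact/measurable_EFinP.
  by move=> *; rewrite lee_fin.
apply: eq_measure_integral => A mA _; apply/esym.
apply: (@lebesgue_measure_unique R nu) => // _ [[u v] _ <-].
transitivity (a%:E * leb ((fun x : R => (a * x + b)%R) @^-1` `]u, v]))%E; last by [].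
rewrite (_ : _ @^-1` _ = `](u - b) / a, (v - b) / a]%classic).
  rewrite !lebesgue_measure_itv/= !lte_fin ltr_pM2r ?invr_gt0// ltrD2r.
  case: ifP => uv; last by rewrite mule0.
  rewrite -!EFinD -EFinM; congr EFin; field; exact: lt0r_neq0.
apply/seteqP; split=> x /=; rewrite !in_itv/= ltr_pdivrMr// ler_pdivlMr//;
  by rewrite ltrBlDr lerBrDr (mulrC x).
Qed.

Lemma normal_pdf_scale (s x : R) : 0 < s ->
  normal_pdf 0 s x = s^-1 * normal_pdf 0 1 (s^-1 * x).
Proof.
move=> s0; rewrite !normal_pdfE ?oner_neq0 ?gt_eqF// /normal_peak /normal_fun.
rewrite !subr0 expr1n mul1r -mulrnAr sqrtrM ?sqr_ge0// sqrtr_sqr gtr0_norm//.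
rewrite invfM mulrA; congr (_ * expR _).
rewrite -(mulr_natl (s ^+ 2)); field; rewrite gt_eqF//.
Qed.

Lemma normal_pdf_shift (s x : R) :
  normal_pdf 0 1 (x - s) = expR (s * x - s ^+ 2 / 2) * normal_pdf 0 1 x.
Proof.
rewrite !normal_pdfE ?oner_neq0// /normal_fun !subr0 mulrCA -expRD.
by congr (_ * expR _); rewrite expr1n; field.
Qed.

Lemma normal_prob_scale (s : R) B : 0 < s -> measurable B ->
  normal_prob 0 s [set x | B (s^-1 * x)] = gam B.
Proof.
move=> s0 mB.
have mi : measurable_fun setT (fun x => \1_B x * normal_pdf (0 : R) 1 x).
  by apply: measurable_funM => //; exact: measurable_normal_pdf.
have i0 x : 0 <= \1_B x * normal_pdf (0 : R) 1 x by rewrite mulr_ge0 ?normal_pdf_ge0.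
rewrite /normal_prob integral_mkcond [RHS]integral_mkcond.
have E A m' s' : (EFin \o normal_pdf m' s') \_ A =
    (fun x => (\1_A x * normal_pdf m' s' x)%:E).
  by apply/funext => x; rewrite epatch_indic/= muleC EFinM.
rewrite !E -[RHS](@ge0_integral_lebesgue_affine s^-1 0) ?invr_gt0//.
by apply: eq_integral => x _; rewrite addr0 normal_pdf_scale// mulrCA.
Qed.

Lemma ge0_integral_normal_prob (f : R -> R) : measurable_fun setT f ->
  (forall x, 0 <= f x) ->
  (\int[gam]_x (f x)%:E = \int[leb]_x (f x * normal_pdf 0 1 x)%:E)%E.
Proof.
move=> mf f0; rewrite (@ge0_integral_density _ _ _ leb _ (normal_pdf 0 1))//.
- exact: measurable_normal_pdf.
- by move=> x; exact: normal_pdf_ge0.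
Qed.

(** One-dimensional Cameron-Martin formula: Lebesgue measure is translation invariant, and
    [normal_pdf_shift] gives the ratio of the two densities. *)
Lemma ge0_integral_normal_shift (s : R) (f : R -> R) : measurable_fun setT f ->
  (forall x, 0 <= f x) ->
  (\int[gam]_x (f (x + s))%:E =
   \int[gam]_x (f x * expR (s * x - s ^+ 2 / 2))%:E)%E.
Proof.
move=> mf f0.
have ms : measurable_fun setT (fun x : R => x + s) by exact: measurable_funD.
have mms : measurable_fun setT (fun x : R => x - s) by exact: measurable_funD.
rewrite !ge0_integral_normal_prob//.
- rewrite -[RHS](@ge0_integral_lebesgue_affine 1 s)//.
  + apply: eq_integral => x _; rewrite !mul1r -mulrA -normal_pdf_shift.
    by rewrite addrK.
  + apply: measurable_funM; last exact: measurable_normal_pdf.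
    apply: measurable_funM => //; apply: measurableT_comp => //.
    by apply: measurable_funB => //; exact: measurable_funM.
  + by move=> x; rewrite !mulr_ge0 ?expR_ge0 ?normal_pdf_ge0.
- apply: measurable_funM => //; apply: measurableT_comp => //.
  by apply: measurable_funB => //; exact: measurable_funM.
- by move=> x; rewrite mulr_ge0 ?expR_ge0.
- exact: measurableT_comp.
Qed.

(** Multiplied by exp (k x^2), the standard density becomes t^-1 times the density of N(0, t^-2),
    with t^2 = 1 - 2 k. *)
Lemma integral_normal_expR_sqr (k : R) : 2 * k < 1 ->
  (\int[gam]_x (expR (k * x ^+ 2))%:E = ((Num.sqrt (1 - 2 * k))^-1)%:E)%E.
Proof.
move=> k1; set t := Num.sqrt _.
have t2 : t ^+ 2 = 1 - 2 * k by rewrite sqr_sqrtr// subr_ge0 ltW.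
have t0 : 0 < t by rewrite sqrtr_gt0 subr_gt0.
rewrite ge0_integral_normal_prob//; last first.
  - by apply: measurableT_comp => //; apply: measurable_funM => //; exact: measurable_funX.
transitivity (\int[leb]_x (t^-1%:E * (normal_pdf 0 t^-1 x)%:E))%E; last first.
  rewrite ge0_integralZl//; last 3 first.
  - by apply/measurable_EFinP; exact: measurable_normal_pdf.
  - by move=> x _; rewrite lee_fin normal_pdf_ge0.
  - by rewrite lee_fin invr_ge0 ltW.
  by rewrite integral_normal_pdf mule1.
apply: eq_integral => x _; rewrite -EFinM; congr EFin.
rewrite (@normal_pdf_scale t^-1) ?invr_gt0// invrK mulKf ?gt_eqF//.
rewrite !normal_pdfE ?oner_neq0// /normal_fun !subr0 mulrCA -expRD.
by congr (_ * expR _); rewrite exprMn t2 expr1n; field.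
Qed.

End one_dimensional_gaussian.

(** * Gaussian matrices *)

Lemma measurable_preim d1 d2 (T1 : measurableType d1) (T2 : measurableType d2)
    (f : T1 -> T2) (B : set T2) :
  measurable_fun setT f -> measurable B -> measurable (f @^-1` B).
Proof. by move=> mf mB; rewrite -[X in measurable X]setTI; exact: mf. Qed.

Section boxes.
Context {R : realType} (m n : nat).
Local Notation V := 'M[R]_(m, n).
Local Notation gam := (normal_prob (0 : R) 1).

Definition box (B : 'I_m -> 'I_n -> set R) : set V :=
  [set M | forall i j, B i j (M i j)].

Definition boxes : set (set V) :=
  [set A | exists2 B, (forall i j, measurable (B i j)) & A = box B].

Lemma measurable_coord (i : 'I_m) (j : 'I_n) :
  measurable_fun setT (fun M : V => M i j).
Proof. by move: i j; apply/measurable_fun_mxP. Qed.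

Lemma measurable_box B : (forall i j, measurable (B i j)) -> measurable (box B).
Proof.
move=> mB; rewrite (_ : box B = \bigcap_(ij in [set: 'I_m * 'I_n])
    ((fun M : V => M ij.1 ij.2) @^-1` B ij.1 ij.2)).
  apply: fin_bigcap_measurable => // ij _.
  by rewrite -[X in measurable X]setTI; exact: measurable_coord.
apply/seteqP; split=> [M BM [i j] _|M BM i j]; first exact: BM.
exact: (BM (i, j)).
Qed.

Lemma setI_closed_boxes : setI_closed boxes.
Proof.
move=> _ _ [B mB ->] [C mC ->]; exists (fun i j => B i j `&` C i j).
  by move=> i j; exact: measurableI.
apply/seteqP; split=> [M [BM CM] i j|M BCM]; first by split.
by split=> i j; have [] := BCM i j.
Qed.

Lemma measurable_boxesE : measurable = <<s boxes >>.
Proof.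
apply/seteqP; split; last first.
  apply: smallest_sub; first exact: sigma_algebra_measurable.
  by move=> _ [B mB ->]; exact: measurable_box.
apply: smallest_sub; first exact: smallest_sigma_algebra.
move=> _ [i [j [B mB ->]]]; apply: sub_sigma_algebra.
exists (fun a b => if (a == i) && (b == j) then B else setT).
  by move=> a b; case: ifP.
apply/seteqP; split=> [M BM a b|M /(_ i j)] /=; last by rewrite !eqxx.
by case: ifP => // /andP[/eqP -> /eqP ->].
Qed.

Lemma boxT : box (fun _ _ => setT) = setT.
Proof. by apply/seteqP; split. Qed.

Lemma eq_measure_boxes (mu nu : {measure set V -> \bar R}) :
  (mu setT < +oo)%E ->
  (forall B, (forall i j, measurable (B i j)) -> mu (box B) = nu (box B)) ->
  forall A, measurable A -> mu A = nu A.
Proof.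
move=> fmu E A mA.
apply: (measure_unique boxes (fun=> setT) measurable_boxesE setI_closed_boxes) => //.
- by move=> i; exists (fun _ _ => setT); rewrite ?boxT.
- by rewrite bigcup_const.
- by move=> _ [B mB ->]; exact: E.
Qed.

(** Boxes form a generating pi-system, so these values determine the law on the whole product
    sigma-algebra ([eq_measure_boxes]). *)
Definition standard_gaussian_mx (mu : set V -> \bar R) :=
  forall B, (forall i j, measurable (B i j)) ->
    mu (box B) = (\prod_(ij : 'I_m * 'I_n) gam (B ij.1 ij.2))%E.

Definition set_entry i j (x : R) (M : V) : V :=
  \matrix_(a, b) if (a == i) && (b == j) then x else M a b.

Lemma measurable_fun_set_entry d (T : measurableType d) i j (f : T -> R)
    (g : T -> V) : measurable_fun setT f -> measurable_fun setT g ->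
  measurable_fun setT (fun t => set_entry i j (f t) (g t)).
Proof.
move=> mf mg; apply/measurable_fun_mxP => a b.
rewrite (_ : (fun _ => _) = (fun t => if (a == i) && (b == j) then f t else g t a b));
  last by apply/funext => t; rewrite mxE.
by case: (_ && _) => //; exact: (measurableT_comp (measurable_coord a b) mg).
Qed.

Lemma measurable_set_entry i j :
  measurable_fun setT (fun xM : R * V => set_entry i j xM.1 xM.2).
Proof. exact: measurable_fun_set_entry. Qed.

Lemma set_entry_id i j (M : V) : set_entry i j (M i j) M = M.
Proof.
by apply/matrixP => a b; rewrite mxE; case: ifP => // /andP[/eqP -> /eqP ->].
Qed.

Lemma set_entryK i j x y (M : V) : set_entry i j x (set_entry i j y M) = set_entry i j x M.
Proof. by apply/matrixP => a b; rewrite !mxE; case: (_ && _). Qed.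

Lemma set_entryE i j x (M : V) : set_entry i j x M i j = x.
Proof. by rewrite mxE !eqxx. Qed.

Section entry_fubini.
Variable mu : probability V R.
Hypothesis gmu : standard_gaussian_mx mu.

(** Overwriting one entry by an independent N(0, 1) variable preserves the law, as a comparison on
    boxes shows. This gives Fubini in a single entry without writing the matrix space as a
    product. *)
Lemma set_entry_gaussian i j A : measurable A ->
  mu A = (gam \x mu)%E ((fun xM : R * V => set_entry i j xM.1 xM.2) @^-1` A).
Proof.
move=> mA.
pose nu_ : {measure set V -> \bar R} :=
  measure_function.pushforward (gam \x mu)%E (fun xM : R * V => set_entry i j xM.1 xM.2).
pose nu := nu_ (measurable_set_entry i j).
suff : mu A = nu A by [].
apply: eq_measure_boxes => // [|B mB]; first exact: fin_num_fun_lty.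
 pose B' a b := if (a == i) && (b == j) then setT else B a b.
have mB' a b : measurable (B' a b) by rewrite /B'; case: ifP.
have -> : nu (box B) = (gam \x mu)%E (B i j `*` box B').
  rewrite /nu/= /pushforward; congr ((gam \x mu)%E _).
  apply/seteqP; split=> [[x M] /= BxM|[x M] /= [Bx BM] a b].
    split; first by have := BxM i j; rewrite set_entryE.
    by move=> a b; have := BxM a b; rewrite mxE /B'; case: ifP.
  rewrite mxE; have := BM a b; rewrite /B'; case: ifP => //.
  by move=> /andP[/eqP -> /eqP ->].
rewrite product_measure1E; [|exact: mB|exact: measurable_box].
transitivity (gam (B i j) * \prod_(ab : 'I_m * 'I_n) gam (B' ab.1 ab.2))%E; last first.
  by congr (_ * _)%E; exact/esym/gmu.
transitivity (\prod_(ab : 'I_m * 'I_n) gam (B ab.1 ab.2))%E; first exact: gmu.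
rewrite (bigD1 (i, j))//= [in RHS](bigD1 (i, j))//=.
rewrite /B' !eqxx/= probability_setT mul1e; congr (_ * _)%E.
by apply: eq_bigr => -[a b]; rewrite xpair_eqE/= => /negbTE ->.

Qed.

Lemma ge0_integral_set_entry i j (phi : V -> R) :
  measurable_fun setT phi -> (forall M, 0 <= phi M) ->
  (\int[mu]_M (phi M)%:E =
   \int[mu]_M \int[gam]_x (phi (set_entry i j x M))%:E)%E.
Proof.
move=> mphi phi0; have ms := measurable_set_entry i j.
pose nu_ : {measure set V -> \bar R} :=
  measure_function.pushforward (gam \x mu)%E (fun xM : R * V => set_entry i j xM.1 xM.2).
pose nu := nu_ (measurable_set_entry i j).
transitivity (\int[nu]_M (phi M)%:E)%E.
  by apply: eq_measure_integral => A mA _; exact: set_entry_gaussian.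
rewrite ge0_integral_pushforward//=; last 2 first.
- exact/measurable_EFinP.
- by move=> *; rewrite lee_fin.
rewrite fubini_tonelli2//=.
- by apply/measurable_EFinP; exact: (measurableT_comp mphi ms).
- by move=> x; rewrite lee_fin.
Qed.

End entry_fubini.
End boxes.

(** * Transport of the Gaussian law by transvections *)

Section transvections.
Context {R : realType} (m n : nat).
Local Notation V := 'M[R]_(m, n).
Local Notation gam := (normal_prob (0 : R) 1).
Implicit Types (B C M : V).

Definition rowdot M B (i : 'I_m) : R := \sum_l M i l * B i l.

(** Row i is multiplied on the right by I + b_i^T c_i. When b_i is orthogonal to c_i, this matrix
    has determinant 1 and inverse I - b_i^T c_i. *)
Definition transvect B C M : V := \matrix_(i, j) (M i j + rowdot M B i * C i j).

Definition sqnorm M : R := \sum_(ij : 'I_m * 'I_n) M ij.1 ij.2 ^+ 2.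

Definition row_orthogonal B C := forall i, rowdot C B i = 0.

Lemma measurable_rowdot B i : measurable_fun setT (fun M => rowdot M B i).
Proof.
apply: measurable_sum => l; apply: measurable_funM => //.
exact: measurable_coord.
Qed.

Lemma measurable_transvect B C : measurable_fun setT (transvect B C).
Proof.
apply/measurable_fun_mxP => i j.
rewrite (_ : (fun M => _) = (fun M => M i j + rowdot M B i * C i j)); last first.
  by apply/funext => M; rewrite mxE.
apply: measurable_funD; first exact: measurable_coord.
by apply: measurable_funM => //; exact: measurable_rowdot.
Qed.

Lemma measurable_sqnorm : measurable_fun setT sqnorm.
Proof.
by apply: measurable_sum => ij; apply: measurable_funX; exact: measurable_coord.
Qed.

Lemma rowdot_transvect B C M i : row_orthogonal B C ->
  rowdot (transvect B C M) B i = rowdot M B i.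
Proof.
move=> BC; rewrite {1}/rowdot.
under eq_bigr do rewrite mxE mulrDl -mulrA.
by rewrite big_split/= -mulr_sumr -/(rowdot C B i) BC mulr0 addr0.
Qed.

Lemma transvectD B C C' M : row_orthogonal B C' ->
  transvect B C (transvect B C' M) = transvect B (C + C') M.
Proof.
move=> BC'; apply/matrixP => i j; rewrite mxE rowdot_transvect// !mxE.
by rewrite mulrDr -addrA [X in _ + X]addrC.
Qed.

Lemma transvect0 B M : transvect B 0 M = M.
Proof. by apply/matrixP => i j; rewrite !mxE mulr0 addr0. Qed.

Lemma row_orthogonalN B C : row_orthogonal B C -> row_orthogonal B (- C).
Proof.
move=> BC i; rewrite -[RHS]oppr0 -(BC i) /rowdot -sumrN.
by apply: eq_bigr => l _; rewrite mxE mulNr.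
Qed.

Lemma row_orthogonalD B C C' : row_orthogonal B C -> row_orthogonal B C' ->
  row_orthogonal B (C + C').
Proof.
move=> BC BC' i; rewrite -[RHS]addr0 -{1}(BC i) -(BC' i) /rowdot -big_split/=.
by apply: eq_bigr => l _; rewrite mxE mulrDl.
Qed.

Lemma row_orthogonal0 B : row_orthogonal B 0.
Proof. by move=> i; rewrite /rowdot big1// => l _; rewrite mxE mul0r. Qed.

Lemma rowdot_delta B i j k a : rowdot (a *: delta_mx i j) B k =
  a * (k == i)%:R * B k j.
Proof.
rewrite /rowdot (bigD1 j)//= !mxE eqxx andbT big1 ?addr0// => l lj.
by rewrite !mxE (negbTE lj) andbF mulr0 mul0r.
Qed.

Lemma rowdot_deltar M i j k : rowdot M (delta_mx i j) k = M k j * (k == i)%:R.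
Proof.
rewrite /rowdot (bigD1 j)//= !mxE eqxx andbT big1 ?addr0// => l lj.
by rewrite !mxE (negbTE lj) andbF mulr0.
Qed.

Lemma sqnorm_set_entry i j x y M :
  sqnorm (set_entry i j x M) - sqnorm (set_entry i j y M) = x ^+ 2 - y ^+ 2.
Proof.
rewrite /sqnorm (bigD1 (i, j))//= [in X in _ - X](bigD1 (i, j))//= !set_entryE.
rewrite opprD addrACA -[RHS]addr0; congr (_ + _); apply/eqP.
rewrite subr_eq0; apply/eqP/eq_bigr => -[a b].
by rewrite xpair_eqE/= !mxE => /negbTE ->.
Qed.

Section gaussian_transport.
Variable mu : probability V R.
Hypothesis gmu : standard_gaussian_mx mu.

(* A volume-preserving map T with inverse T' transports the Gaussian law into
   the law with density exp ((|M|^2 - |T' M|^2) / 2); this form of the density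
   makes the property stable under composition. *)
Definition gaussian_transport (T T' : V -> V) : Prop :=
  [/\ measurable_fun setT T, measurable_fun setT T', cancel T T' &
      forall phi : V -> R, measurable_fun setT phi -> (forall M, 0 <= phi M) ->
        (\int[mu]_M (phi (T M))%:E =
         \int[mu]_M (phi M * expR ((sqnorm M - sqnorm (T' M)) / 2))%:E)%E].

(** The exponents telescope: |M|^2 - |T2' M|^2 and |T2' M|^2 - |T1' T2' M|^2 add up to the exponent
    of the composition. *)
Lemma gaussian_transport_comp T1 T1' T2 T2' :
  gaussian_transport T1 T1' -> gaussian_transport T2 T2' ->
  gaussian_transport (T2 \o T1) (T1' \o T2').
Proof.
move=> [mT1 mT1' K1 I1] [mT2 mT2' K2 I2]; split.
- exact: measurableT_comp.
- exact: measurableT_comp.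
- exact: can_comp.
move=> phi mphi phi0.
have mphi2 : measurable_fun setT (phi \o T2) by exact: measurableT_comp.
etransitivity; first exact: (I1 _ mphi2 (fun M => phi0 (T2 M))).
pose D1 M := expR ((sqnorm M - sqnorm (T1' M)) / 2).
have mD1 : measurable_fun setT D1.
  apply: measurableT_comp => //; apply: measurable_funM => //.
  apply: measurable_funB; first exact: measurable_sqnorm.
  exact: (measurableT_comp measurable_sqnorm).
(* The cancellation [K2] makes the density of the first map a function of [T2 M], to which the
   formula for [T2] applies. *)
transitivity (\int[mu]_M ((fun M => phi M * D1 (T2' M)) (T2 M))%:E)%E.
  by apply: eq_integral => M _; rewrite /= K2.
have mphiD : measurable_fun setT (fun M => phi M * D1 (T2' M)).
  by apply: measurable_funM => //; exact: measurableT_comp.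
etransitivity; first apply: (I2 _ mphiD) => M.
  by rewrite mulr_ge0 ?expR_ge0.
apply: eq_integral => M _; rewrite -mulrA -expRD/=.
by congr ((_ * expR _)%:E); rewrite -mulrDl; congr (_ / _); ring.
Qed.

Lemma gaussian_transport_id : gaussian_transport id id.
Proof.
split=> // phi _ _; apply: eq_integral => M _.
by rewrite subrr mul0r expR0 mulr1.
Qed.

(** As [f] ignores entry (i, j), it is constant in the inner integral over that entry, where the map
    is a translation of N(0, 1). *)
Lemma gaussian_transport_set_entry i j (f : V -> R) : measurable_fun setT f ->
  (forall x M, f (set_entry i j x M) = f M) ->
  gaussian_transport (fun M => set_entry i j (M i j + f M) M)
                     (fun M => set_entry i j (M i j - f M) M).
Proof.
move=> mf fE.
have mT : measurable_fun setT (fun M : V => set_entry i j (M i j + f M) M).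
  apply: measurable_fun_set_entry => //.
  by apply: measurable_funD => //; exact: measurable_coord.
have mT' : measurable_fun setT (fun M : V => set_entry i j (M i j - f M) M).
  apply: measurable_fun_set_entry => //.
  by apply: measurable_funB => //; exact: measurable_coord.
split=> //.
  by move=> M /=; rewrite set_entryE set_entryK fE addrK set_entry_id.
move=> phi mphi phi0.
pose psi M := phi M * expR ((sqnorm M - sqnorm (set_entry i j (M i j - f M) M)) / 2).
have mpsi : measurable_fun setT psi.
  apply: measurable_funM => //; apply: measurableT_comp => //.
  apply: measurable_funM => //; apply: measurable_funB.
    exact: measurable_sqnorm.
  exact: (measurableT_comp measurable_sqnorm mT').
have psi0 M : 0 <= psi M by rewrite mulr_ge0 ?expR_ge0.
etransitivity; first exact: (ge0_integral_set_entry gmu i j (measurableT_comp mphi mT) (fun M => phi0 _)).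
etransitivity; last exact/esym/(ge0_integral_set_entry gmu i j mpsi psi0).
apply: eq_integral => M _.
have mphiM : measurable_fun setT (fun x => phi (set_entry i j x M)).
  by apply: measurableT_comp => //; exact: measurable_fun_set_entry.
transitivity (\int[gam]_x (phi (set_entry i j (x + f M) M))%:E)%E.
  by apply: eq_integral => x _; rewrite /= set_entryE fE set_entryK.
etransitivity; first exact: (ge0_integral_normal_shift _ mphiM).
apply: eq_integral => x _; rewrite /psi set_entryE fE set_entryK.
by rewrite sqnorm_set_entry; congr ((_ * expR _)%:E); field.
Qed.

Lemma gaussian_transport_ext T1 T1' T2 T2' : T1 =1 T2 -> T1' =1 T2' ->
  gaussian_transport T1 T1' -> gaussian_transport T2 T2'.
Proof. by move=> /funext -> /funext ->. Qed.

(** Orthogonality is kept with the transport property because [transvectD] uses it; the conjunction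
    is stable under sums of [C] and thus fit for [big_ind]. *)
Let good B C := row_orthogonal B C /\
  gaussian_transport (transvect B C) (transvect B (- C)).

Let goodD B C C' : good B C -> good B C' -> good B (C + C').
Proof.
move=> [BC gC] [BC' gC']; split; first exact: row_orthogonalD.
apply: gaussian_transport_ext (gaussian_transport_comp gC' gC) => M /=.
  by rewrite transvectD.
by rewrite transvectD ?opprD 1?addrC//; exact: row_orthogonalN.
Qed.

Let good0 B : good B 0.
Proof.
split; first exact: row_orthogonal0.
by apply: gaussian_transport_ext gaussian_transport_id => M;
  rewrite ?oppr0 transvect0.
Qed.

(** The hypothesis makes the increment of entry (i, j), [rowdot M B i * a], independent of that
    entry itself. *)
Let good_delta B i j a : a * B i j = 0 -> good B (a *: delta_mx i j).
Proof.
move=> aB; have BC : row_orthogonal B (a *: delta_mx i j).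
  move=> k; rewrite rowdot_delta; case: eqVneq => [->|_].
    by rewrite mulr1.
  by rewrite mulr0 mul0r.
split=> //.
apply: gaussian_transport_ext
  (@gaussian_transport_set_entry i j (fun M => rowdot M B i * a) _ _).
- move=> M; apply/matrixP => k l; rewrite !mxE.
  by case: eqVneq => [->|_]; case: eqVneq => [->|_] /=; rewrite ?mulr1 ?mulr0 ?addr0.
- move=> M; apply/matrixP => k l; rewrite !mxE.
  by case: eqVneq => [->|_]; case: eqVneq => [->|_] /=;
    rewrite !(mulr1, mulr0, oppr0, addr0, mulrN).
- by apply: measurable_funM => //; exact: measurable_rowdot.
move=> x M; rewrite /rowdot !mulr_suml; apply: eq_bigr => l _.
rewrite mxE eqxx/=; case: eqVneq => [->|//].
by rewrite -!mulrA [B i j * a]mulrC aB !mulr0.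
Qed.

(** [C] is a sum of multiples of elementary matrices. Each term satisfies the condition of
    [good_delta]: [delta_mx i j] vanishes away from (i, j), and [C] vanishes there. *)
Let good_pivot i j C : C i j = 0 -> good (delta_mx i j) C.
Proof.
move=> Cij; rewrite [C]matrix_sum_delta.
apply: (big_ind (good _)) => [||k _]; [exact: good0|exact: goodD|].
apply: (big_ind (good _)) => [||l _]; [exact: good0|exact: goodD|].
apply: good_delta; rewrite mxE; case: eqVneq => [->|_]; last by rewrite mulr0.
by case: eqVneq => [->|_]; rewrite ?Cij ?mul0r ?mulr0.
Qed.

(* Conjugating by a transvection reduces row i of C to the single entry
   (i, j), where j is a pivot. *)
Let good_row B C i : rowdot C B i = 0 ->
  good B (\matrix_(k, l) ((k == i)%:R * C k l)).
Proof.
move=> CB; set Ci := \matrix_(k, l) _.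
have BCi : row_orthogonal B Ci.
  move=> k; rewrite /rowdot; case: (eqVneq k i) => [->|ki].
    by rewrite -[RHS]CB; apply: eq_bigr => l _; rewrite mxE eqxx mul1r.
  by rewrite big1// => l _; rewrite mxE (negbTE ki) !mul0r.
have [/forallP Ci0|] := boolP [forall l, C i l == 0].
  rewrite (_ : Ci = 0); first exact: good0.
  apply/matrixP => k l; rewrite !mxE; case: eqVneq => [->|_].
    by rewrite (eqP (Ci0 l)) mulr0.
  by rewrite mul0r.
rewrite negb_forall => /existsP[j Cij].
split=> //.
(* Conjugation by the pivot transvection along [D] sends e_j to C_i / C_ij, hence turns the single
   entry C_ij e_j into the row C_i. [B'] drops column j of [B], which makes the middle factor
   elementary. *)
pose D : V := \matrix_(k, l) ((k == i)%:R * (C i l / C i j - (l == j)%:R)).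
pose B' : V := \matrix_(k, l) (if l == j then 0 else B k l).
have Dij : D i j = 0 by rewrite mxE !eqxx divff// subrr mulr0.
have [oD gD] := good_pivot Dij.
have [oD' gD'] : good (delta_mx i j) (- D).
  by apply: good_pivot; rewrite mxE Dij oppr0.
have [_ gS] : good B' (C i j *: delta_mx i j).
  by apply: good_delta; rewrite mxE eqxx mulr0.
rewrite opprK in gD'.
(* The scalar a covers the transvection (a = 1) and its inverse (a = -1) at once. *)
have key a M : transvect (delta_mx i j) D
    (transvect B' ((a * C i j) *: delta_mx i j) (transvect (delta_mx i j) (- D) M)) =
    transvect B (a *: Ci) M.
  set M1 := transvect _ (- D) M.
  have M1E k l : M1 k l = M k l - M k j * D k l.
    rewrite !mxE rowdot_deltar; case: eqVneq => [_|_]; first by rewrite mulr1 mulrN.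
    by rewrite mulr0 !mul0r mulr0 addr0 subr0.
  have M1B : rowdot M1 B' i = rowdot M B i.
    rewrite /rowdot (bigD1 j)//= [RHS](bigD1 j)//= [B' i j]mxE eqxx mulr0 add0r.
    under eq_bigr => l lj.
      rewrite M1E !mxE (negbTE lj) eqxx mul1r subr0.
      rewrite (_ : _ * _ = M i l * B i l - M i j / C i j * (C i l * B i l)); last by ring.
      over.
    rewrite big_split/= sumrN -mulr_sumr addrC; congr (_ + _).
    (* Orthogonality in row i: the correction - M_ij / C_ij times the sum over l != j restores the
       missing term M_ij B_ij. *)
    have := CB; rewrite /rowdot (bigD1 j)//= => /eqP; rewrite addr_eq0 => /eqP.
    move=> /eqP; rewrite -eqr_oppLR => /eqP <-; field; exact: Cij.
  set M2 := transvect B' _ M1.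
  have M2E k l : M2 k l = M1 k l + rowdot M B i * (a * C i j) * ((k == i) && (l == j))%:R.
    rewrite !mxE; case: eqVneq => [->|_] /=; last by rewrite !mulr0.
    by rewrite M1B; ring.
  have CiE k l : (a *: Ci) k l = a * ((k == i)%:R * C k l) by rewrite !mxE.
  have DE k l : D k l = (k == i)%:R * (C i l / C i j - (l == j)%:R) by rewrite mxE.
  apply/matrixP => k l; rewrite mxE rowdot_deltar [RHS]mxE CiE.
  rewrite !M2E !M1E !DE eqxx andbT.
  case: (eqVneq k i) => [->|ki]; rewrite /= ?mulr0 ?mul0r ?mulr0 ?subr0 ?addr0//.
  by rewrite !mul1r !mulr1; field; exact: Cij.
apply: gaussian_transport_ext
  (gaussian_transport_comp gD' (gaussian_transport_comp gS gD)) => M /=.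
  by have := key 1 M; rewrite mul1r scale1r.
by have := key (-1) M; rewrite mulN1r !scaleN1r scaleNr.
Qed.

Theorem gaussian_transport_transvect B C : row_orthogonal B C ->
  gaussian_transport (transvect B C) (transvect B (- C)).
Proof.
move=> BC; suff [] : good B C by [].
rewrite (_ : C = \sum_i \matrix_(k, l) ((k == i)%:R * C k l)); last first.
  apply/matrixP => k l; rewrite summxE (bigD1 k)//= mxE eqxx mul1r.
  by rewrite big1 ?addr0// => i ik; rewrite mxE eq_sym (negbTE ik) mul0r.
apply: (big_ind (good _)) => [||i _]; [exact: good0|exact: goodD|].
exact: good_row.
Qed.

End gaussian_transport.
End transvections.

(** * Density of a transvected Gaussian matrix and its second moment *)

Section transvection_density.
Context {R : realType} (m n : nat).
Local Notation V := 'M[R]_(m, n).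
Local Notation gam := (normal_prob (0 : R) 1).
Implicit Types (B C M : V).

(** With h_i = M_i . b_i, the exponent is half of |M_i|^2 - |M_i - h_i c_i|^2, summed over the rows:
    the likelihood ratio for a shift of row i by h_i c_i. *)
Definition transvect_density B C M : R :=
  expR (\sum_i (rowdot M B i * rowdot M C i - rowdot M B i ^+ 2 * rowdot C C i / 2)).

Lemma measurable_transvect_density B C :
  measurable_fun setT (transvect_density B C).
Proof.
apply: measurableT_comp => //; apply: measurable_sum => i.
have mr (D : V) : measurable_fun setT (fun M => rowdot M D i) by exact: measurable_rowdot.
apply: measurable_funB; first exact: measurable_funM.
by do 2 apply: measurable_funM => //; exact: measurable_funX.
Qed.

Lemma transvect_densityE B C M :
  expR ((sqnorm M - sqnorm (transvect B (- C) M)) / 2) = transvect_density B C M.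
Proof.
congr expR; rewrite /sqnorm -sumrB mulr_suml.
rewrite -(pair_bigA _ (fun i j => (M i j ^+ 2 - transvect B (- C) M i j ^+ 2) / 2))/=.
apply: eq_bigr => i _; under eq_bigr do rewrite !mxE.
set h := rowdot M B i; rewrite /rowdot !mulr_sumr mulr_suml -sumrB; by apply: eq_bigr => j _; field.
Qed.

Lemma rowdotC M B i : rowdot M B i = rowdot B M i.
Proof. by apply: eq_bigr => l _; rewrite mulrC. Qed.

Lemma row_orthogonalC B C : row_orthogonal B C -> row_orthogonal C B.
Proof. by move=> BC i; rewrite rowdotC. Qed.

Lemma rowdot_ge0 C i : 0 <= rowdot C C i.
Proof. by apply: sumr_ge0 => l _; rewrite -expr2 sqr_ge0. Qed.

Section gaussian.
Variable mu : probability V R.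
Hypothesis gmu : standard_gaussian_mx mu.

Lemma ge0_integral_transvect B C (phi : V -> R) : row_orthogonal B C ->
  measurable_fun setT phi -> (forall M, 0 <= phi M) ->
  (\int[mu]_M (phi (transvect B C M))%:E =
   \int[mu]_M (phi M * transvect_density B C M)%:E)%E.
Proof.
move=> BC mphi phi0; have [_ _ _] := gaussian_transport_transvect gmu BC.
move=> /(_ phi mphi phi0); under [X in _ = X -> _]eq_integral.
  by move=> M _; rewrite transvect_densityE; over.
by [].
Qed.

Lemma measurable_expR_rowdot_sqr (a : 'I_m -> R) B :
  measurable_fun setT (fun M => expR (\sum_i a i * rowdot M B i ^+ 2)).
Proof.
apply: measurableT_comp => //; apply: measurable_sum => i.
by apply: measurable_funM => //; apply: measurable_funX; exact: measurable_rowdot.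
Qed.

(* The square of the density for C is the density for 2 C times the exponential
   of a function that the transvection by 2 C leaves invariant. *)
Lemma integral_transvect_density_sqr B C : row_orthogonal B C ->
  (\int[mu]_M (transvect_density B C M ^+ 2)%:E =
   \int[mu]_M (expR (\sum_i rowdot C C i * rowdot M B i ^+ 2))%:E)%E.
Proof.
move=> BC; have BC2 : row_orthogonal B (C + C) by exact: row_orthogonalD.
have := ge0_integral_transvect BC2
  (measurable_expR_rowdot_sqr (rowdot C C) B) (fun M => expR_ge0 _).
under eq_integral.
  move=> M _; under eq_bigr do rewrite rowdot_transvect//.
  over.
move=> ->; apply: eq_integral => M _; congr EFin.
rewrite -expRD -expRM_natl -big_split/= mulr_sumr; congr expR.
apply: eq_bigr => i _.
have -> : rowdot M (C + C) i = 2 * rowdot M C i.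
  by rewrite /rowdot mulr_sumr; apply: eq_bigr => l _; rewrite mxE; ring.
have -> : rowdot (C + C) (C + C) i = 4 * rowdot C C i.
  by rewrite /rowdot mulr_sumr; apply: eq_bigr => l _; rewrite mxE; ring.
by field.
Qed.

Let integral_expR_rowdot_sqr_prod B C : row_orthogonal B C ->
  (\int[mu]_M (expR (\sum_i rowdot C C i / 2 * rowdot M B i ^+ 2))%:E =
   \int[mu]_M (expR (\sum_i rowdot M B i * rowdot M C i))%:E)%E.
Proof.
move=> BC; have := ge0_integral_transvect BC
  (measurable_expR_rowdot_sqr (fun i => rowdot C C i / 2) B) (fun M => expR_ge0 _).
under eq_integral.
  move=> M _; under eq_bigr do rewrite rowdot_transvect//.
  over.
move=> ->; apply: eq_integral => M _; congr EFin.
by rewrite -expRD -big_split/=; congr expR; apply: eq_bigr => i _; field.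
Qed.

(* Both sides are the integral of exp (sum_i (M . B)_i (M . C)_i). Taking C
   supported by one column reduces a linear form to a coordinate. *)
Lemma integral_expR_rowdot_sqrC B C : row_orthogonal B C ->
  (\int[mu]_M (expR (\sum_i rowdot C C i / 2 * rowdot M B i ^+ 2))%:E =
   \int[mu]_M (expR (\sum_i rowdot B B i / 2 * rowdot M C i ^+ 2))%:E)%E.
Proof.
move=> BC; etransitivity; first exact: integral_expR_rowdot_sqr_prod.
etransitivity; last exact/esym/integral_expR_rowdot_sqr_prod/row_orthogonalC.
by apply: eq_integral => M _; under eq_bigr do rewrite mulrC.
Qed.

(** The entries of a column are independent N(0, 1) variables, so the integral factors. *)
Lemma integral_expR_col_sqr (a : 'I_m -> R) (k : 'I_n) :
  (forall i, 2 * a i < 1) ->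
  (\int[mu]_M (expR (\sum_i a i * M i k ^+ 2))%:E =
   (\prod_i (Num.sqrt (1 - 2 * a i))^-1)%:E)%E.
Proof.
move=> a1.
have mf s : measurable_fun setT (fun M : V => expR (\sum_(i <- s) a i * M i k ^+ 2)).
  apply: measurableT_comp => //; apply: measurable_sum => i.
  by apply: measurable_funM => //; apply: measurable_funX; exact: measurable_coord.
(* Since the index list has no duplicates, overwriting row i leaves the remaining terms
   unchanged. *)
elim: (index_enum _) (index_enum_uniq 'I_m) => [_|i s IH /= /andP[si us]].
  rewrite big_nil; under eq_integral do rewrite big_nil expR0.
  by rewrite integral_cst// mul1e; exact: probability_setT.
rewrite (ge0_integral_set_entry gmu i k (mf _) (fun M => expR_ge0 _)).
rewrite big_cons EFinM -IH//.
set c := (_^-1)%:E; pose F M := (expR (\sum_(j <- s) a j * M j k ^+ 2))%:E.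
have c0 : (0 <= c)%E by rewrite lee_fin invr_ge0 sqrtr_ge0.
have mF : measurable_fun setT F by exact/measurable_EFinP.
have F0 M : setT M -> (0 <= F M)%E by rewrite lee_fin expR_ge0.
rewrite -(ge0_integralZl mu measurableT mF F0 c0).
apply: eq_integral => M _; rewrite /c -integral_normal_expR_sqr// muleC.
have mG : measurable_fun setT (fun x : R => (expR (a i * x ^+ 2))%:E).
  apply/measurable_EFinP; apply: measurableT_comp => //.
  by apply: measurable_funM => //; exact: measurable_funX.
have G0 x : setT x -> (0 <= (expR (a i * x ^+ 2))%:E)%E.
  by rewrite lee_fin expR_ge0.
rewrite -(ge0_integralZl gam measurableT mG G0 (F0 M I)).
apply: eq_integral => x _; rewrite -EFinM -expRD big_cons set_entryE addrC.
have -> // : \sum_(j <- s) a j * set_entry i k x M j k ^+ 2 =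
    \sum_(j <- s) a j * M j k ^+ 2.
rewrite big_seq [RHS]big_seq; apply: eq_bigr => j js.
by rewrite mxE; case: eqVneq js => [->|//]; rewrite (negbTE si).
Qed.

(** After squaring and inverting, this follows from exp (4 a) >= 1 + 4 a and (1 + 4 a) (1 - 2 a) = 1
    + 2 a (1 - 4 a) >= 1. *)
Lemma inv_sqrt_le_expR (a : R) : 0 <= a <= 4^-1 ->
  (Num.sqrt (1 - 2 * a))^-1 <= expR (2 * a).
Proof.
move=> /andP[a0 a4]; have p : 0 < 1 - 2 * a by lra.
rewrite -lef_pV2 ?posrE ?invr_gt0 ?sqrtr_gt0 ?expR_gt0// invrK -expRN.
rewrite -(ler_pXn2r (n := 2)) ?nnegrE ?expR_ge0 ?sqrtr_ge0//.
rewrite sqr_sqrtr ?(ltW p)// -expRM_natl mulrN expRN.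
rewrite -[leRHS]invrK lef_pV2 ?posrE ?invr_gt0 ?expR_gt0//.
apply: le_trans (expR_ge1Dx _); rewrite -div1r ler_pdivrMr//.
nra.
Qed.

(** The second moment depends on [C] only through its row norms. Replacing [C] by a matrix carried
    by column [k], where [B] vanishes, keeps orthogonality; exchanging the roles of the two matrices
    then leaves Gaussian integrals in single entries. *)
Lemma integral_transvect_density_sqr_le B C (k : 'I_n) (v : R) :
  row_orthogonal B C -> (forall i, B i k = 0) -> v <= 4^-1 ->
  (forall i, rowdot C C i * rowdot B B i <= v) ->
  (\int[mu]_M (transvect_density B C M ^+ 2)%:E <= (expR (2 * m%:R * v))%:E)%E.
Proof.
move=> BC Bk v4 CBv; rewrite integral_transvect_density_sqr//.
(* The factor 2 compensates the 1/2 in [integral_expR_rowdot_sqrC]. *)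
pose E : V := \matrix_(i, j) (Num.sqrt (2 * rowdot C C i) * (j == k)%:R).
have rE M i : rowdot M E i = Num.sqrt (2 * rowdot C C i) * M i k.
  rewrite /rowdot (bigD1 k)//= mxE eqxx mulr1 big1 ?addr0 1?mulrC// => l lk.
  by rewrite mxE (negbTE lk) !mulr0.
have BE : row_orthogonal B E by move=> i; rewrite rowdotC rE Bk mulr0.
have EE i : rowdot E E i / 2 = rowdot C C i.
  rewrite rE mxE eqxx mulr1 -expr2 sqr_sqrtr ?mulr_ge0 ?rowdot_ge0//.
  by field.
under eq_integral.
  move=> M _; under eq_bigr do rewrite -EE.
  over.
rewrite integral_expR_rowdot_sqrC//.
under eq_integral.
  move=> M _; under eq_bigr => i _.
    rewrite rE exprMn sqr_sqrtr ?mulr_ge0 ?rowdot_ge0// mulrA.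
    rewrite (_ : _ / 2 * _ = rowdot C C i * rowdot B B i); last by field.
    over.
  over.
have CB0 i : 0 <= rowdot C C i * rowdot B B i by rewrite mulr_ge0 ?rowdot_ge0.
rewrite integral_expR_col_sqr; last by move=> i; have := CBv i; lra.
rewrite lee_fin; apply: (@le_trans _ _ (\prod_(i < m) expR (2 * v))).
  apply: ler_prod => i _; rewrite invr_ge0 sqrtr_ge0/=.
  apply: (le_trans (inv_sqrt_le_expR _)).
    by rewrite CB0/=; apply: le_trans v4.
  by rewrite ler_expR ler_pM2l.
rewrite prodr_const card_ord -expRM_natl ler_expR.
by rewrite le_eqVlt; apply/orP; left; apply/eqP; ring.
Qed.

(** The left side is the integral of L 1_A for the density L. The weight [kappa] trades the second
    moment of L against mu A; it is later taken proportional to the number of positions in a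
    block. *)
Theorem transvect_preimage_le B C (k : 'I_n) (v kappa : R) (A : set V) :
  row_orthogonal B C -> (forall i, B i k = 0) -> v <= 4^-1 ->
  (forall i, rowdot C C i * rowdot B B i <= v) -> 0 < kappa -> measurable A ->
  (mu (transvect B C @^-1` A) <=
   (expR (2 * m%:R * v) / (2 * kappa))%:E + (kappa / 2)%:E * mu A)%E.
Proof.
move=> BC Bk v4 CBv k0 mA.
have mT := measurable_transvect B C.
have mTA : measurable (transvect B C @^-1` A).
  by rewrite -[X in measurable X]setTI; exact: mT.
have mL := measurable_transvect_density B C.
have mf : measurable_fun setT (fun M => transvect_density B C M ^+ 2 / (2 * kappa)).
  by apply: measurable_funM => //; exact: measurable_funX.
have mg : measurable_fun setT (fun M : V => kappa / 2 * \1_A M).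
  by apply: measurable_funM => //; exact: measurable_indic.
have -> : mu (transvect B C @^-1` A) =
    (\int[mu]_M (\1_A M * transvect_density B C M)%:E)%E.
  have ind0 (M : V) : 0 <= \1_A M :> R by [].
  have mI : measurable_fun setT (\1_A : V -> R) by exact: measurable_indic.
  rewrite -(ge0_integral_transvect BC mI ind0).
  transitivity (\int[mu]_M (\1_(transvect B C @^-1` A) M)%:E)%E.
    by rewrite integral_indic// setIT.
  by [].
apply: (@le_trans _ _ (\int[mu]_M
    (transvect_density B C M ^+ 2 / (2 * kappa) + kappa / 2 * \1_A M)%:E)%E).
  apply: ge0_le_integral => //.
  - by move=> M _; rewrite lee_fin mulr_ge0 ?expR_ge0.
  - by apply/measurable_EFinP; apply: measurable_funM => //; exact: measurable_indic.
  - by apply/measurable_EFinP; exact: measurable_funD.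
  (* The difference is (L - kappa 1_A)^2 / (2 kappa), since 1_A is its own square. *)
  - move=> M _; rewrite lee_fin -subr_ge0.
    rewrite (_ : _ - _ = (transvect_density B C M - kappa * \1_A M) ^+ 2 / (2 * kappa)).
      by rewrite divr_ge0 ?sqr_ge0// mulr_ge0// ltW.
    by rewrite indicE; case: (_ \in _) => /=; field; exact: lt0r_neq0.
under eq_integral do rewrite EFinD.
rewrite ge0_integralD//; last 4 first.
- by move=> M _; rewrite lee_fin divr_ge0 ?sqr_ge0// mulr_ge0// ltW.
- exact/measurable_EFinP.
- by move=> M _; rewrite lee_fin mulr_ge0// divr_ge0// ltW.
- exact/measurable_EFinP.
apply: leeD.
  under eq_integral do rewrite mulrC EFinM.
  rewrite ge0_integralZl//; last 3 first.
  - by apply/measurable_EFinP; exact: measurable_funX.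
  - by move=> M _; rewrite lee_fin sqr_ge0.
  - by rewrite lee_fin invr_ge0 mulr_ge0// ltW.
  rewrite [X in (_ <= X%:E)%E]mulrC EFinM lee_pmul2l//; last by rewrite lte_fin invr_gt0 mulr_gt0.
  exact: (integral_transvect_density_sqr_le BC Bk).
under eq_integral do rewrite EFinM.
rewrite ge0_integralZl//; last 2 first.
- by apply/measurable_EFinP; exact: measurable_indic.
- by rewrite lee_fin divr_ge0// ltW.
by rewrite integral_indic// setIT.
Qed.

End gaussian.
End transvection_density.

(** * The observation as a function of a standard Gaussian matrix *)

Lemma posdef_unitmx (R : realType) p (S : 'M[R]_p) :
  positive_definite S -> S \in unitmx.
Proof.
move=> [_ S0]; rewrite -row_free_unit; apply: inj_row_free => v vS.
by apply: contrapT => /eqP/S0; rewrite vS mul0mx mxE ltxx.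
Qed.

Lemma factor_unitmx (R : realType) p (A S : 'M[R]_p) :
  positive_definite S -> A^T *m A = S -> A \in unitmx.
Proof.
move=> /posdef_unitmx S1 AS; move: S1; rewrite -AS !unitmxE det_mulmx det_tr.
by rewrite unitrM => /andP[].
Qed.

Section noise.
Context {R : realType} (n p : nat) (sigma sigmas : R) (A : 'I_n -> 'M[R]_p).
Local Notation N := (1 + (p + p))%N.

Definition xi_idx : 'I_N := lshift (p + p) ord0.
Definition X_idx (j : 'I_p) : 'I_N := rshift 1 (lshift p j).
Definition W_idx (j : 'I_p) : 'I_N := rshift 1 (rshift p j).

(* The columns of M carry the standardized noises: xi, then the Gaussian
   vectors generating the rows of X, then W. *)
Definition noise_design (M : 'M[R]_(n, N)) : 'M[R]_(n, p) :=
  \matrix_(i, k) \sum_j M i (X_idx j) * A i j k.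

Definition noise_observation (theta : 'cV[R]_p) (M : 'M[R]_(n, N)) :
    'cV[R]_n * 'M[R]_(n, p) :=
  (noise_design M *m theta + \col_i (sigma * M i xi_idx),
   noise_design M + \matrix_(i, j) (sigmas * M i (W_idx j))).

(** Recovers the standardized noises from xi, X and W. The factor [A] is indexed by rows because
    [gaussian_vector] supplies one factor per row. *)
Definition noise_of (xi : 'cV[R]_n) (X W : 'M[R]_(n, p)) : 'M[R]_(n, N) :=
  row_mx (\col_i (sigma^-1 * xi i 0))
    (row_mx (\matrix_(i, j) (row i X *m invmx (A i)) 0 j)
            (\matrix_(i, j) (sigmas^-1 * W i j))).

Lemma noise_of_xi xi X W i : noise_of xi X W i xi_idx = sigma^-1 * xi i 0.
Proof. by rewrite row_mxEl mxE. Qed.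

Lemma noise_of_X xi X W i j :
  noise_of xi X W i (X_idx j) = (row i X *m invmx (A i)) 0 j.
Proof. by rewrite row_mxEr row_mxEl mxE. Qed.

Lemma noise_of_W xi X W i j : noise_of xi X W i (W_idx j) = sigmas^-1 * W i j.
Proof. by rewrite row_mxEr row_mxEr mxE. Qed.

Lemma noise_ofK xi X W theta : 0 < sigma -> 0 < sigmas ->
  (forall i, A i \in unitmx) ->
  noise_observation theta (noise_of xi X W) = (X *m theta + xi, X + W).
Proof.
move=> s0 t0 uA; have -> : noise_observation theta (noise_of xi X W) =
    (X *m theta + \col_i (sigma * noise_of xi X W i xi_idx),
     X + \matrix_(i, j) (sigmas * noise_of xi X W i (W_idx j))).
  rewrite /noise_observation; suff -> : noise_design (noise_of xi X W) = X by [].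
  apply/matrixP => i k; rewrite mxE.
  under eq_bigr do rewrite noise_of_X.
  transitivity ((row i X *m invmx (A i) *m A i) 0 k); first by rewrite [RHS]mxE.
  by rewrite mulmxKV// mxE.
congr (_ + _, _ + _); apply/matrixP => i j.
  by rewrite mxE noise_of_xi mulrA divff ?mul1r ?gt_eqF// ord1.
by rewrite mxE noise_of_W mulrA divff ?mul1r ?gt_eqF.
Qed.

End noise.

Section measurable_mx_maps.
Context {R : realType} (n p : nat).

Lemma measurable_mulmxr k (A : 'M[R]_(p, k)) :
  measurable_fun setT (fun v : 'M[R]_(n, p) => v *m A).
Proof.
apply/measurable_fun_mxP => i j.
rewrite (_ : (fun _ => _) = (fun v : 'M[R]_(n, p) => \sum_l v i l * A l j)); last first.
  by apply/funext => v; rewrite mxE.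
by apply: measurable_sum => l; apply: measurable_funM => //; exact: measurable_coord.
Qed.

Lemma measurable_row i : measurable_fun setT (fun X : 'M[R]_(n, p) => row i X).
Proof.
apply/measurable_fun_mxP => a b.
rewrite (_ : (fun _ => _) = (fun X : 'M[R]_(n, p) => X i b)).
  exact: measurable_coord.
by apply/funext => X; rewrite mxE.
Qed.

End measurable_mx_maps.

Section observation_law_gaussian.
Context {R : realType} (n p : nat) (sigma sigmas : R) (Sigma : 'M[R]_p).
Context d (Omega : measurableType d) (P : probability Omega R).
Variables (xi : {RV P >-> 'cV[R]_n}) (X W : {RV P >-> 'M[R]_(n, p)}).
Local Notation N := (1 + (p + p))%N.
Local Notation gam := (normal_prob (0 : R) 1).
Hypotheses (sigma0 : 0 < sigma) (sigmas0 : 0 < sigmas).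
Hypothesis pdS : positive_definite Sigma.
Hypothesis model : errors_in_variables P sigma sigmas Sigma xi X W.

Section with_factors.
Variable A : 'I_n -> 'M[R]_p.
Hypothesis uA : forall i, A i \in unitmx.
Hypothesis iidG : forall i,
  iid_centered_gaussian P 1 (fun j w => (row i (X w) *m invmx (A i)) 0 j).

Let nu w := noise_of sigma sigmas A (xi w) (X w) (W w).

Lemma measurable_noise : measurable_fun setT nu.
Proof.
apply/measurable_fun_mxP => i j; have [j1|j1 Ej] := splitP j.
  move=> Ej; rewrite (_ : (fun _ => _) = (fun w => sigma^-1 * xi w i 0)); last first.
    apply/funext => w; rewrite -(noise_of_xi sigma sigmas A _ (X w) (W w)).
    by congr (_ _ _); apply/val_inj; rewrite /= Ej ord1.
  apply: measurable_funM => //.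
  exact: (measurableT_comp (measurable_coord i 0)).
have [j2 Ej1|j2 Ej1] := splitP j1.
  rewrite (_ : (fun _ => _) = (fun w => (row i (X w) *m invmx (A i)) 0 j2)); last first.
    apply/funext => w; rewrite -(noise_of_X sigma sigmas A (xi w) _ (W w)).
    by congr (_ _ _); apply/val_inj; rewrite /= Ej Ej1.
  have mr : measurable_fun setT (fun w => row i (X w) *m invmx (A i)).
    apply: (measurableT_comp (measurable_mulmxr _)).
    exact: (measurableT_comp (measurable_row i)).
  exact: (measurableT_comp (measurable_coord 0 j2) mr).
rewrite (_ : (fun _ => _) = (fun w => sigmas^-1 * W w i j2)); last first.
  apply/funext => w; rewrite -(noise_of_W sigma sigmas A (xi w) (X w)).
  by congr (_ _ _); apply/val_inj; rewrite /= Ej Ej1.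
apply: measurable_funM => //.
exact: (measurableT_comp (measurable_coord i j2)).
Qed.

Lemma scaled_gaussian (s : R) (Y : Omega -> R) B : 0 < s -> measurable B ->
  centered_gaussian P s Y -> P [set w | B (s^-1 * Y w)] = gam B.
Proof.
move=> s0 mB [mY PY]; rewrite -(normal_prob_scale s0 mB) -PY//.
apply: (@measurable_preim _ _ _ _ (fun x : R => s^-1 * x)) => //.
exact: measurable_funM.
Qed.

(** The preimage of a box is an intersection of events on xi, X and W. Independence of the triplet
    factors it, independence of the rows splits the event on X, and the i.i.d. entries do the
    rest. *)
Lemma noise_gaussian B : (forall i j, measurable (B i j)) ->
  P (nu @^-1` box B) = (\prod_(ij : 'I_n * 'I_N) gam (B ij.1 ij.2))%E.
Proof.
move=> mB; have [triplet gxi gW indrows _] := model.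
pose B1 : set 'cV[R]_n :=
  [set x | forall i, B i (xi_idx p) (sigma^-1 * x i 0)].
pose C i : set 'rV[R]_p :=
  [set r | forall j, B i (X_idx j) ((r *m invmx (A i)) 0 j)].
pose B2 : set 'M[R]_(n, p) := [set x | forall i, C i (row i x)].
pose B3 : set 'M[R]_(n, p) :=
  [set x | forall i j, B i (W_idx j) (sigmas^-1 * x i j)].
have mscale (s : R) D : measurable D -> measurable [set x : R | D (s^-1 * x)].
  move=> mD; apply: (@measurable_preim _ _ _ _ (fun x : R => s^-1 * x)) => //.
  exact: measurable_funM.
have mB1 : measurable B1.
  rewrite (_ : B1 = box (fun i (j : 'I_1) => [set x | B i (xi_idx p) (sigma^-1 * x)])).
    by apply: measurable_box => i j; exact: mscale.
  apply/seteqP; split=> [x Bx i j|x Bx i]; last exact: (Bx i 0).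
  by rewrite (ord1 j); exact: Bx.
have mC i : measurable (C i).
  rewrite (_ : C i = (fun r => r *m invmx (A i)) @^-1`
      box (fun (_ : 'I_1) j => B i (X_idx j))).
    apply: measurable_preim; first exact: measurable_mulmxr.
    by apply: measurable_box.
  apply/seteqP; split=> [r Br a j|r Br j]; last exact: (Br 0 j).
  by rewrite (ord1 a); exact: Br.
have mB2 : measurable B2.
  rewrite (_ : B2 = \bigcap_(i in [set: 'I_n]) ((fun x => row i x) @^-1` C i)).
    apply: fin_bigcap_measurable => // i _.
    by apply: measurable_preim => //; exact: measurable_row.
  by apply/seteqP; split=> [x Bx i _|x Bx i]; exact: Bx.
have mB3 : measurable B3.
  rewrite (_ : B3 = box (fun i j => [set x | B i (W_idx j) (sigmas^-1 * x)]))//.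
  by apply: measurable_box => i j; exact: mscale.
have -> : nu @^-1` box B = xi @^-1` B1 `&` X @^-1` B2 `&` W @^-1` B3.
  apply/seteqP; split=> w /=.
    move=> Bw; split; first split.
    - by move=> i; have := Bw i (xi_idx p); rewrite noise_of_xi.
    - by move=> i j; have := Bw i (X_idx j); rewrite noise_of_X.
    - by move=> i j; have := Bw i (W_idx j); rewrite noise_of_W.
  move=> [[w1 w2] w3] i j; have [j1 Ej|j1 Ej] := splitP j.
    rewrite (_ : j = xi_idx p); last by apply/val_inj; rewrite /= Ej ord1.
    by rewrite noise_of_xi.
  have [j2 Ej1|j2 Ej1] := splitP j1.
    rewrite (_ : j = X_idx j2); last by apply/val_inj; rewrite /= Ej Ej1.
    by rewrite noise_of_X; exact: w2.
  rewrite (_ : j = W_idx j2); last by apply/val_inj; rewrite /= Ej Ej1.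
  by rewrite noise_of_W; exact: w3.
rewrite triplet//.
have -> : P (xi @^-1` B1) = (\prod_i gam (B i (xi_idx p)))%E.
  have [ind gau] := gxi.
  rewrite (_ : xi @^-1` B1 = \bigcap_i ((fun w => xi w i 0) @^-1`
      [set x | B i (xi_idx p) (sigma^-1 * x)])).
    rewrite ind; last by move=> i; exact: mscale.
    by apply: eq_bigr => i _; exact: scaled_gaussian (gau i).
  by apply/seteqP; split=> [w Bw i _|w Bw i]; exact: Bw.
have -> : P (X @^-1` B2) = (\prod_i \prod_j gam (B i (X_idx j)))%E.
  rewrite (_ : X @^-1` B2 = \bigcap_i ((fun w => row i (X w)) @^-1` C i)).
    rewrite indrows//; apply: eq_bigr => i _.
    rewrite (_ : _ @^-1` _ = \bigcap_j ((fun w => (row i (X w) *m invmx (A i)) 0 j)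
        @^-1` B i (X_idx j))).
      have [ind gau] := iidG i; rewrite ind//.
      by apply: eq_bigr => j _; have [_ ->] := gau j.
    by apply/seteqP; split=> [w Bw j _|w Bw j]; exact: Bw.
  by apply/seteqP; split=> [w Bw i _|w Bw i]; exact: Bw.
have -> : P (W @^-1` B3) = (\prod_i \prod_j gam (B i (W_idx j)))%E.
  have [ind gau] := gW; rewrite pair_bigA/=.
  rewrite (_ : W @^-1` B3 = \bigcap_ij ((fun w => W w ij.1 ij.2) @^-1`
      [set x | B ij.1 (W_idx ij.2) (sigmas^-1 * x)])).
    rewrite ind; last by move=> ij; exact: mscale.
    by apply: eq_bigr => ij _; exact: scaled_gaussian (gau ij).
  apply/seteqP; split=> [w Bw [i j] _|w Bw i j]; first exact: Bw.
  exact: (Bw (i, j)).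
rewrite -(pair_bigA _ (fun i j => gam (B i j)))/= -!big_split/=.
apply: eq_bigr => i _; rewrite big_split_ord/= big_ord1 -muleA; congr (_ * _)%E.
by rewrite big_split_ord.
Qed.

End with_factors.

(** [A] and [mu] do not depend on theta, so the laws for all parameters are images of one Gaussian
    measure under explicit maps. *)
Theorem observation_law_gaussian :
  exists (A : 'I_n -> 'M[R]_p) (mu : probability 'M[R]_(n, N) R),
    [/\ standard_gaussian_mx mu, forall i, (A i)^T *m A i = Sigma &
      forall theta B, observation_law P xi X W theta B =
        mu (noise_observation sigma sigmas A theta @^-1` B)].
Proof.
have [_ _ _ _ gX] := model.
have /choice[A HA] : forall i, exists Ai : 'M[R]_p, Ai^T *m Ai = Sigma /\
    iid_centered_gaussian P 1 (fun j w => (row i (X w) *m invmx Ai) 0 j).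
  move=> i; have [Ai [G [AS iidG XE]]] := gX i; exists Ai; split=> //.
  have uA := factor_unitmx pdS AS.
  rewrite (_ : (fun _ => _) = fun j w => G w 0 j)//.
  by apply/funext => j; apply/funext => w; rewrite XE mulmxK.
have uA i : A i \in unitmx by have [/(factor_unitmx pdS)] := HA i.
pose nu w := noise_of sigma sigmas A (xi w) (X w) (W w).
have mnu : measurable_fun setT nu by exact: measurable_noise.
pose nu' : {RV P >-> 'M[R]_(n, N)} := HB.pack nu (isMeasurableFun.Build _ _ _ _ _ mnu).
exists A, (distribution P nu'); split.
- by move=> B mB; apply: noise_gaussian => // i; have [] := HA i.
- by move=> i; have [] := HA i.
move=> theta B; rewrite /observation_law /distribution /pushforward.
congr (P _); apply/seteqP; split=> w /=; by rewrite noise_ofK.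
Qed.

End observation_law_gaussian.

(** * Extreme eigenvalues and quadratic forms *)

Section rayleigh.
Context {R : realType} (p : nat).
Implicit Types (S : 'M[R]_p) (v w : 'rV[R]_p).

Definition bilin S v w : R := (v *m S *m w^T) 0 0.

Lemma bilinDl S u v w : bilin S (u + v) w = bilin S u w + bilin S v w.
Proof. by rewrite /bilin !mulmxDl mxE. Qed.

Lemma bilinDr S u v w : bilin S w (u + v) = bilin S w u + bilin S w v.
Proof. by rewrite /bilin linearD/= mulmxDr mxE. Qed.

Lemma bilinZl S a v w : bilin S (a *: v) w = a * bilin S v w.
Proof. by rewrite /bilin -!scalemxAl mxE. Qed.

Lemma bilinZr S a v w : bilin S w (a *: v) = a * bilin S w v.
Proof. by rewrite /bilin linearZ/= -scalemxAr mxE. Qed.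

Lemma bilinC S v w : S^T = S -> bilin S v w = bilin S w v.
Proof.
move=> ST; transitivity ((v *m S *m w^T)^T 0 0); first by rewrite mxE.
by rewrite !trmx_mul trmxK ST mulmxA.
Qed.

Lemma bilinE S v w : bilin S v w = \sum_j (\sum_i v 0 i * S i j) * w 0 j.
Proof. by rewrite /bilin mxE; apply: eq_bigr => j _; rewrite !mxE. Qed.

Lemma bilin1 v : bilin 1%:M v v = \sum_i v 0 i ^+ 2.
Proof. by rewrite /bilin mulmx1 mxE; apply: eq_bigr => i _; rewrite mxE. Qed.

Lemma bilin1_ge0 v : 0 <= bilin 1%:M v v.
Proof. by rewrite bilin1; apply: sumr_ge0 => i _; exact: sqr_ge0. Qed.

Lemma bilin1_eq0 v : bilin 1%:M v v = 0 -> v = 0.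
Proof.
rewrite bilin1 => /eqP; rewrite psumr_eq0 => [/allP v0|i _]; last exact: sqr_ge0.
apply/rowP => i; rewrite mxE; apply/eqP; rewrite -sqrf_eq0.
by apply: v0; rewrite mem_index_enum.
Qed.

Lemma continuous_sum (T : topologicalType) (I : Type) (s : seq I) (F : I -> T -> R) :
  (forall i, continuous (F i)) -> continuous (fun x => \sum_(i <- s) F i x).
Proof.
move=> cF x; elim: s => [|i s IH].
  rewrite (_ : (fun _ => _) = cst 0); first exact: cvg_cst.
  by apply/funext => y; rewrite big_nil.
rewrite (_ : (fun _ => _) = (fun y => F i y + \sum_(j <- s) F j y)); last first.
  by apply/funext => y; rewrite big_cons.
by apply: cvgD => //; exact: cF.
Qed.

Lemma continuous_mul (T : topologicalType) (f g : T -> R) :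
  continuous f -> continuous g -> continuous (fun x => f x * g x).
Proof. by move=> cf cg x; apply: cvgM; [exact: cf|exact: cg]. Qed.

Lemma continuous_bilin S : continuous (fun v => bilin S v v).
Proof.
rewrite (_ : (fun _ => _) = (fun v => \sum_j (\sum_i v 0 i * S i j) * v 0 j)); last first.
  by apply/funext => v; exact: bilinE.
have cc i : continuous (fun v : 'rV[R]_p => v 0 i) by exact: coord_continuous.
have cS j : continuous (fun v : 'rV[R]_p => \sum_i v 0 i * S i j).
  apply: (@continuous_sum _ _ _ (fun i (v : 'rV[R]_p) => v 0 i * S i j)) => i.
  by apply: continuous_mul; [exact: cc|exact: cst_continuous].
apply: (@continuous_sum _ _ _
  (fun j (v : 'rV[R]_p) => (\sum_i v 0 i * S i j) * v 0 j)) => j.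
by apply: continuous_mul; [exact: cS|exact: cc].
Qed.

(* A minimizer of the quadratic form on the sphere is an eigenvector. *)
Lemma smallest_eigenvalue_bilin S (a : R) v : S^T = S ->
  smallest_eigenvalue S a -> a * bilin 1%:M v v <= bilin S v v.
Proof.
move=> ST [/eigenvalueP[e eS e0] amin].
pose K := [set w : 'rV[R]_p | bilin 1%:M w w = 1].
have n0 w : w != 0 -> 0 < bilin 1%:M w w.
  move=> w0; rewrite lt_neqAle bilin1_ge0 andbT eq_sym.
  by apply: contra w0 => /eqP/bilin1_eq0 ->.
have normK w : w != 0 -> K ((Num.sqrt (bilin 1%:M w w))^-1 *: w).
  move=> w0; rewrite /K/= bilinZl bilinZr mulrA -invfM -expr2 sqr_sqrtr ?bilin1_ge0//.
  by rewrite mulVf// gt_eqF// n0.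
have K0 : K !=set0 by exists ((Num.sqrt (bilin 1%:M e e))^-1 *: e); exact: normK.
have cK : compact K.
  apply: bounded_closed_compact; last first.
    apply: (@preimage_closed _ _ _ [set 1 : R]); last exact: closed_eq.
    by move=> w _; exact: continuous_bilin.
  exists 1; split=> // x x1 w Kw; apply: le_trans (ltW x1).
  rewrite [leLHS]/Num.norm/= mx_normrE; apply: bigmax_le => // -[i j] _ /=.
  rewrite (ord1 i) -(@ler_pXn2r _ 2) ?nnegrE// expr1n real_normK ?num_real//.
  rewrite -[leRHS]Kw bilin1 (bigD1 j)//= lerDl.
  by apply: sumr_ge0 => l _; exact: sqr_ge0.
have [c /set_mem Kc cmin] := EVT_min_rV K0 cK (continuous_subspaceT (@continuous_bilin S)).
set mu := bilin S c c in cmin.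
have q_ge0 w : mu * bilin 1%:M w w <= bilin S w w.
  have [->|w0] := eqVneq w 0; first by rewrite /bilin !mul0mx mxE mulr0.
  have /mem_set/cmin := normK _ w0; rewrite bilinZl bilinZr mulrA -invfM -expr2.
  rewrite sqr_sqrtr ?bilin1_ge0// mulrC ler_pdivlMr// n0//.
have c0 : c != 0.
  apply/eqP => c0; have := Kc; rewrite /K/= c0 /bilin !mul0mx mxE => /esym/eqP.
  by rewrite oner_eq0.
suff cS : c *m S = mu *: c.
  apply: le_trans (q_ge0 v); rewrite ler_wpM2r ?bilin1_ge0//.
  by apply: amin; apply/eigenvalueP; exists c.
apply/eqP; rewrite -subr_eq0; apply/eqP; move yE : (c *m S - mu *: c) => y.
apply: bilin1_eq0; set N := bilin 1%:M y y.
have yN : bilin S c y - mu * bilin 1%:M c y = N.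
  transitivity (bilin 1%:M (c *m S + (- mu) *: c) y); last first.
    by rewrite /N -yE scaleNr.
  rewrite bilinDl bilinZl mulNr; congr (_ - _).
  by rewrite /bilin mulmx1.
have D0 := q_ge0 y; set D := bilin S y y - mu * N.
have D1 : 0 < D + 1 by rewrite ltr_wpDl// subr_ge0.
have cc1 : bilin 1%:M c c = 1 := Kc.
(* First-variation test: moving from the minimizer against the residual y changes the form S - mu I
   by - (D + 2) (N / (D + 1))^2, which must be nonnegative; so N = |y|^2 = 0. The 1 in D + 1 keeps
   the denominator positive. *)
have := q_ge0 (c + (- N / (D + 1)) *: y).
rewrite !(bilinDl, bilinDr, bilinZl, bilinZr) [bilin S y c]bilinC//.
rewrite [bilin 1%:M y c]bilinC ?trmx1// cc1 -subr_ge0 -/mu -/N.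
rewrite (_ : _ - _ = - (D + 2) * (N / (D + 1)) ^+ 2); last first.
  rewrite (_ : bilin S c y = N + mu * bilin 1%:M c y); last by rewrite -yN subrK.
  rewrite (_ : bilin S y y = D + mu * N); last by rewrite subrK.
  by field; exact: lt0r_neq0.
have D2 : 0 < D + 2 by lra.
rewrite mulNr oppr_ge0 pmulr_rle0// => h.
have : (N / (D + 1)) ^+ 2 == 0 by rewrite eq_le h sqr_ge0.
by rewrite sqrf_eq0 mulf_eq0 invr_eq0 [D + 1 == 0]gt_eqF// orbF => /eqP.
Qed.

End rayleigh.

Lemma bilin_delta (R : realType) p (S : 'M[R]_p) k :
  bilin S (delta_mx 0 k) (delta_mx 0 k) = S k k.
Proof.
have E j : \sum_i (delta_mx 0 k : 'rV[R]_p) 0 i * S i j = S k j.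
  rewrite (bigD1 k)//= !mxE !eqxx mul1r big1 ?addr0// => i ik.
  by rewrite mxE (negbTE ik) andbF mul0r.
rewrite bilinE; under eq_bigr do rewrite E.
rewrite (bigD1 k)//= !mxE !eqxx mulr1 big1 ?addr0// => j jk.
by rewrite mxE (negbTE jk) andbF mulr0.
Qed.

Lemma bilin1_delta (R : realType) p (k : 'I_p) :
  bilin 1%:M (delta_mx 0 k) (delta_mx 0 k) = 1 :> R.
Proof. by rewrite bilin_delta mxE eqxx. Qed.

(** The bound for the smallest eigenvalue, applied to - S and a basis vector. *)
Lemma largest_eigenvalue_diag (R : realType) p (S : 'M[R]_p) (b : R) k :
  S^T = S -> largest_eigenvalue S b -> S k k <= b.
Proof.
move=> ST [eb bmax].
have eigN (c : R) : eigenvalue (- S) c = eigenvalue S (- c).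
  apply/eigenvalueP/eigenvalueP => -[v vS v0]; exists v => //.
    by rewrite scaleNr -vS mulmxN opprK.
  by rewrite mulmxN vS scaleNr opprK.
have NSb : smallest_eigenvalue (- S) (- b).
  split; first by rewrite eigN opprK.
  by move=> c; rewrite eigN => /bmax; rewrite lerNl.
have := smallest_eigenvalue_bilin (delta_mx 0 k) _ NSb.
by rewrite bilin1_delta bilin_delta mxE mulr1 lerN2; apply; rewrite linearN/= ST.
Qed.

Lemma smallest_eigenvalue_gt0 (R : realType) p (S : 'M[R]_p) (a : R) :
  positive_definite S -> smallest_eigenvalue S a -> 0 < a.
Proof.
move=> [_ S0] [/eigenvalueP[v vS v0] _]; have := S0 v v0.
rewrite vS -scalemxAl mxE => h.
have : 0 <= bilin 1%:M v v by exact: bilin1_ge0.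
rewrite /bilin mulmx1; move: h; set x := (v *m v^T) 0 0 => h x0.
have xn0 : x != 0 by apply: contraTneq h => ->; rewrite mulr0 ltxx.
by move: h; rewrite pmulr_lgt0// lt_neqAle eq_sym xn0.
Qed.

(** The squared norm is the diagonal entry x_k of the inverse of S, where x S = e_k. Then a x_k^2 <=
    a |x|^2 <= x S x^T = x_k, whence x_k <= 1 / a. *)
Lemma invmx_row_norm_le (R : realType) p (A S : 'M[R]_p) (a : R) (k : 'I_p) :
  positive_definite S -> smallest_eigenvalue S a -> A^T *m A = S ->
  bilin 1%:M (row k (invmx A)) (row k (invmx A)) <= a^-1.
Proof.
move=> pdS Sa AS; have a0 := smallest_eigenvalue_gt0 pdS Sa.
have uA := factor_unitmx pdS AS.
set w := row k (invmx A); pose x := w *m (invmx A)^T.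
have wA : w = x *m A^T by rewrite /x -mulmxA -trmx_mul mulmxV// trmx1 mulmx1.
have wk : w *m A = delta_mx 0 k by rewrite /w -row_mul mulVmx// row1.
have xS : x *m S = delta_mx 0 k by rewrite -AS mulmxA -wA.
have qx : bilin S x x = x 0 k.
  rewrite /bilin xS mxE (bigD1 k)//= big1 => [|l lk].
    by rewrite !mxE !eqxx mul1r addr0.
  by rewrite mxE (negbTE lk) andbF mul0r.
have -> : bilin 1%:M w w = x 0 k.
  have wT : w^T = A *m x^T by rewrite wA trmx_mul trmxK.
  by rewrite -qx /bilin mulmx1 wT {1}wA -AS !mulmxA.
have := smallest_eigenvalue_bilin x (proj1 pdS) Sa; rewrite qx => h.
have xk : x 0 k ^+ 2 <= bilin 1%:M x x.
  rewrite bilin1 (bigD1 k)//= lerDl.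
  by apply: sumr_ge0 => l _; exact: sqr_ge0.
have h2 : a * x 0 k ^+ 2 <= x 0 k by apply: le_trans h; rewrite ler_pM2l.
have [xk0|xk0] := leP (x 0 k) 0; first by apply: le_trans xk0 _; rewrite invr_ge0 ltW.
by rewrite -div1r ler_pdivlMr// mulrC -(ler_pM2r xk0) mul1r -mulrA -expr2.
Qed.

(** * Comparison of two parameters differing in one coordinate *)

Section likelihood_comparison.
Context {R : realType} (n p : nat) (sigma sigmas : R) (A : 'I_n -> 'M[R]_p).
Local Notation N := (1 + (p + p))%N.
Hypotheses (sigma0 : 0 < sigma) (sigmas0 : 0 < sigmas).

Lemma measurable_noise_observation theta :
  measurable_fun setT (noise_observation sigma sigmas A theta).
Proof.
have mD i j : measurable_fun setT (fun M : 'M[R]_(n, N) => noise_design A M i j).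
  rewrite (_ : (fun _ => _) = (fun M : 'M[R]_(n, N) => \sum_l M i (X_idx l) * A i l j)).
    apply: measurable_sum => l; apply: measurable_funM => //.
    exact: measurable_coord.
  by apply/funext => M; rewrite mxE.
apply: measurable_fun_pair; apply/measurable_fun_mxP => i j.
- rewrite (_ : (fun _ => _) = (fun M : 'M[R]_(n, N) => \sum_l noise_design A M i l * theta l j +
      sigma * M i (xi_idx p))); last by apply/funext => M; rewrite !mxE.
  apply: measurable_funD.
    by apply: measurable_sum => l; exact: measurable_funM.
  by apply: measurable_funM => //; exact: measurable_coord.
- rewrite (_ : (fun _ => _) = (fun M : 'M[R]_(n, N) => noise_design A M i j +
      sigmas * M i (W_idx j))); last by apply/funext => M; rewrite !mxE.
  apply: measurable_funD => //.
  by apply: measurable_funM => //; exact: measurable_coord.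
Qed.

Lemma sum_noise_idx (F : 'I_N -> R) :
  \sum_l F l = F (xi_idx p) + \sum_j F (X_idx j) + \sum_j F (W_idx j).
Proof. by rewrite big_split_ord/= big_ord1 big_split_ord/= addrA. Qed.

(* Adding delta at coordinate k of theta changes y by the k-th column h of
   delta X. The same change results from shifting xi by g1 h, column k0 of X by
   g2 h and column k0 of W by - g2 h, as soon as g1 + g2 theta_k0 = 1. *)
Variables (k0 k : 'I_p) (delta g1 g2 : R).

Definition noise_source : 'M[R]_(n, N) :=
  \matrix_i row_mx 0 (row_mx (\row_j (delta * A i j k)) 0).

Definition noise_target : 'M[R]_(n, N) :=
  \matrix_i row_mx (g1 / sigma)%:M
    (row_mx (g2 *: row k0 (invmx (A i))) (- (g2 / sigmas) *: delta_mx 0 k0)).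

Lemma noise_source_xi i : noise_source i (xi_idx p) = 0.
Proof. by rewrite mxE row_mxEl mxE. Qed.

Lemma noise_source_X i j : noise_source i (X_idx j) = delta * A i j k.
Proof. by rewrite mxE row_mxEr row_mxEl mxE. Qed.

Lemma noise_source_W i j : noise_source i (W_idx j) = 0.
Proof. by rewrite mxE row_mxEr row_mxEr mxE. Qed.

Lemma noise_target_xi i : noise_target i (xi_idx p) = g1 / sigma.
Proof. by rewrite mxE row_mxEl mxE. Qed.

Lemma noise_target_X i j : noise_target i (X_idx j) = g2 * invmx (A i) k0 j.
Proof. by rewrite mxE row_mxEr row_mxEl !mxE. Qed.

Lemma noise_target_W i j :
  noise_target i (W_idx j) = - (g2 / sigmas) * (j == k0)%:R.
Proof. by rewrite mxE row_mxEr row_mxEr !mxE eqxx. Qed.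

Lemma rowdot_noise_source M i :
  rowdot M noise_source i = delta * noise_design A M i k.
Proof.
rewrite /rowdot sum_noise_idx noise_source_xi mulr0 add0r mxE mulr_sumr.
rewrite [X in _ + X]big1 ?addr0 => [|j _]; last by rewrite noise_source_W mulr0.
by apply: eq_bigr => j _; rewrite noise_source_X; ring.
Qed.

Hypothesis uA : forall i, A i \in unitmx.
Hypothesis kk0 : k != k0.

Lemma noise_design_target i l :
  noise_design A noise_target i l = g2 * (l == k0)%:R.
Proof.
rewrite mxE; under eq_bigr do rewrite noise_target_X -mulrA.
rewrite -mulr_sumr; congr (_ * _).
by have := congr1 (fun M : 'M[R]_p => M k0 l) (mulVmx (uA i)); rewrite !mxE eq_sym.
Qed.

(** The shift of the design moves only column [k0], whereas its amount is read off column [k]. *)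
Lemma noise_orthogonal : row_orthogonal noise_source noise_target.
Proof.
by move=> i; rewrite rowdot_noise_source noise_design_target (negbTE kk0) !mulr0.
Qed.

Lemma noise_observation_transvect (theta : 'cV[R]_p) M :
  g1 + g2 * theta k0 0 = 1 ->
  noise_observation sigma sigmas A theta (transvect noise_source noise_target M) =
  noise_observation sigma sigmas A (theta + delta *: delta_mx k 0) M.
Proof.
move=> g12.
have DE i l : noise_design A (transvect noise_source noise_target M) i l =
    noise_design A M i l + delta * noise_design A M i k * (g2 * (l == k0)%:R).
  rewrite -(noise_design_target i) [LHS]mxE.
  under eq_bigr do rewrite mxE rowdot_noise_source mulrDl -mulrA.
  by rewrite big_split/= -mulr_sumr; congr (_ + _ * _); rewrite mxE.
congr pair; apply/matrixP => i j; rewrite [LHS]mxE [RHS]mxE.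
- rewrite [in LHS]mxE [X in _ + X = _]mxE [X in _ = _ + X]mxE.
  rewrite [transvect _ _ _ _ _]mxE rowdot_noise_source noise_target_xi.
  rewrite [X in _ = X + _]mxE (ord1 j).
  under eq_bigr do rewrite DE mulrDl.
  under [in RHS]eq_bigr do rewrite [(theta + _) _ _]mxE mulrDr.
  rewrite !big_split/= -!addrA; congr (_ + _).
  rewrite (bigD1 k0)//= big1 ?addr0 => [|l lk]; last first.
    by rewrite (negbTE lk) !mulr0 mul0r.
  rewrite [X in _ = X + _](bigD1 k)//= [X in _ = _ + X + _]big1 ?addr0 => [|l lk]; last first.
    by rewrite !mxE (negbTE lk) !mulr0.
  rewrite !mxE !eqxx !mulr1.
  have -> : g1 = 1 - g2 * theta k0 0 by rewrite -g12 addrK.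
  by field; exact: lt0r_neq0.
- rewrite DE [X in _ + X = _]mxE [X in _ = _ + X]mxE.
  rewrite [transvect _ _ _ _ _]mxE rowdot_noise_source noise_target_W.
  by field; exact: lt0r_neq0.
Qed.

Lemma rowdot_noise_sourceE i :
  rowdot noise_source noise_source i = delta ^+ 2 * ((A i)^T *m A i) k k.
Proof.
rewrite rowdot_noise_source !mxE expr2 -mulrA; congr (_ * _); rewrite mulr_sumr.
by apply: eq_bigr => j _; rewrite noise_source_X !mxE mulrA.
Qed.

Lemma rowdot_noise_targetE i :
  rowdot noise_target noise_target i = (g1 / sigma) ^+ 2 +
    g2 ^+ 2 * (bilin 1%:M (row k0 (invmx (A i))) (row k0 (invmx (A i))) + sigmas^-1 ^+ 2).
Proof.
rewrite /rowdot sum_noise_idx noise_target_xi -expr2 -addrA; congr (_ + _).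
rewrite mulrDr; congr (_ + _).
  rewrite bilin1 mulr_sumr; apply: eq_bigr => j _.
  by rewrite noise_target_X mxE -expr2 exprMn.
rewrite (bigD1 k0)//= big1 ?addr0 => [|j jk].
  by rewrite noise_target_W eqxx mulr1 -expr2 sqrrN exprMn.
by rewrite noise_target_W (negbTE jk) !mulr0.
Qed.

End likelihood_comparison.

(** The squared row norm of [noise_source] is delta^2 Sigma_kk <= delta^2 lmax; that of
    [noise_target] involves a diagonal entry of the inverse of Sigma, at most 1 / lmin. Their
    product is therefore at most [v]. *)
Theorem observation_law_le (R : realType) (n p : nat) (sigma sigmas lmin lmax : R)
    (Sigma : 'M[R]_p) d (Omega : measurableType d) (P : probability Omega R)
    (xi : {RV P >-> 'cV[R]_n}) (X W : {RV P >-> 'M[R]_(n, p)})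
    (theta : 'cV[R]_p) (k0 k : 'I_p) (delta g1 g2 v kappa : R)
    (E : set ('cV[R]_n * 'M[R]_(n, p))) :
  0 < sigma -> 0 < sigmas -> positive_definite Sigma ->
  smallest_eigenvalue Sigma lmin -> largest_eigenvalue Sigma lmax ->
  errors_in_variables P sigma sigmas Sigma xi X W ->
  k != k0 -> g1 + g2 * theta k0 0 = 1 -> v <= 4^-1 ->
  ((g1 / sigma) ^+ 2 + g2 ^+ 2 * (lmin^-1 + sigmas^-1 ^+ 2)) *
    (delta ^+ 2 * lmax) <= v ->
  0 < kappa -> measurable E ->
  (observation_law P xi X W (theta + delta *: delta_mx k 0)%R E <=
   (expR (2 * n%:R * v) / (2 * kappa))%:E +
   (kappa / 2)%:E * observation_law P xi X W theta E)%E.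
Proof.
move=> s0 ss0 pdS Smin Smax model kk0 g12 v4 hv kap0 mE.
have [A [mu [gmu AS lawE]]] := observation_law_gaussian s0 ss0 pdS model.
have uA i : A i \in unitmx by exact: factor_unitmx pdS (AS i).
rewrite !lawE.
have mo := measurable_noise_observation sigma sigmas A theta.
have -> : noise_observation sigma sigmas A (theta + delta *: delta_mx k 0) @^-1` E =
    transvect (noise_source A k delta) (noise_target sigma sigmas A k0 g1 g2)
      @^-1` (noise_observation sigma sigmas A theta @^-1` E).
  by apply/seteqP; split=> M /=; rewrite noise_observation_transvect.
(* The column of xi, where [noise_source] vanishes, is the free column required by the second-moment
   bound. *)
apply: (transvect_preimage_le gmu (noise_orthogonal _ _ _ _ _ uA kk0)
  (noise_source_xi A k delta)) => //; last exact: measurable_preim.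
move=> i; rewrite rowdot_noise_sourceE rowdot_noise_targetE AS.
apply: le_trans hv; apply: ler_pM.
- by rewrite addr_ge0 ?sqr_ge0// mulr_ge0 ?sqr_ge0// addr_ge0 ?sqr_ge0 ?bilin1_ge0.
- rewrite mulr_ge0 ?sqr_ge0// -bilin_delta ltW// (proj2 pdS)//.
  apply/eqP => /matrixP/(_ 0 k); rewrite !mxE !eqxx => /eqP.
  by rewrite oner_eq0.
- rewrite lerD2l ler_wpM2l ?sqr_ge0// lerD2r.
  exact: invmx_row_norm_le pdS Smin (AS i).
- rewrite ler_wpM2l ?sqr_ge0//.
  exact: largest_eigenvalue_diag (proj1 pdS) Smax.
Qed.

(** * Reduction to testing in blocks *)

Section lq_norm_facts.
Context {R : realType} (p : nat).
Implicit Types (x : 'cV[R]_p) (q : \bar R).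

Lemma lq_norm_ge0 q x : 0 <= lq_norm q x.
Proof.
case: q => [r| |]//=; first exact: powR_ge0.
by elim/big_ind: _ => // a b a0 b0; rewrite le_max a0.
Qed.

Lemma measurable_lq_norm q : measurable_fun setT (lq_norm q : 'cV[R]_p -> R).
Proof.
have mn i : measurable_fun setT (fun x : 'cV[R]_p => `|x i 0|).
  by apply: measurableT_comp => //; exact: measurable_coord.
case: q => [r| |] /=; last exact: measurable_cst.
  apply: (measurableT_comp (measurable_powR r^-1)); apply: measurable_sum => i.
  exact: (measurableT_comp (measurable_powR r)).
have mb s : measurable_fun setT
    (fun x : 'cV[R]_p => \big[Num.max/0]_(i <- s) `|x i 0|).
  elim: s => [|i s IH].
    rewrite (_ : (fun _ => _) = cst 0); first exact: measurable_cst.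
    by apply/funext => x; rewrite big_nil.
  rewrite (_ : (fun _ => _) =
      (fun x => Num.max `|x i 0| (\big[Num.max/0]_(j <- s) `|x j 0|))).
    exact: measurable_maxr.
  by apply/funext => x; rewrite big_cons.
exact: mb.
Qed.

Lemma ler_powR2r (s a b : R) : 0 <= s -> 0 <= a -> a <= b -> a `^ s <= b `^ s.
Proof.
by move=> s0 a0 ab; apply: (ge0_ler_powR s0); rewrite ?nnegrE// (le_trans a0).
Qed.

Lemma lq_norm_ge q x (eta : R) (I : {set 'I_p}) : (1 <= q)%E -> 0 <= eta ->
  (0 < #|I|)%N -> (forall i, i \in I -> eta <= `|x i 0|) ->
  #|I|%:R `^ inv_exponent q * eta <= lq_norm q x.
Proof.
move=> q1 eta0 I0 xI; case: q q1 => [r| |]//= q1.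
  have r0 : 0 < r by rewrite (lt_le_trans ltr01)// -lee_fin.
  have -> : #|I|%:R `^ r^-1 * eta = #|I|%:R `^ r^-1 * (eta `^ r) `^ r^-1.
    by rewrite -powRrM mulfV ?gt_eqF// powRr1.
  rewrite -powRM ?powR_ge0//; apply: ler_powR2r; first by rewrite invr_ge0 ltW.
    by rewrite mulr_ge0 ?powR_ge0.
  rewrite mulr_natl -sumr_const [leRHS](bigID (mem I))/=.
  rewrite -[leLHS]addr0 lerD//; last by apply: sumr_ge0 => i _; exact: powR_ge0.
  by apply: ler_sum => i iI; apply: ler_powR2r => //; [exact: ltW|exact: xI].
rewrite powRr0 mul1r; have [i iI] : exists i, i \in I by apply/set0Pn; rewrite -card_gt0.
by apply: le_trans (xI _ iI) _; exact: le_bigmax.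
Qed.

Lemma lq_norm2 x : lq_norm 2%:E x = Num.sqrt (\sum_i x i 0 ^+ 2).
Proof.
rewrite /= powR12_sqrt; last by apply: sumr_ge0 => i _; exact: powR_ge0.
congr Num.sqrt; apply: eq_bigr => i _; rewrite powR_mulrn//.
by rewrite real_normK// num_real.
Qed.

End lq_norm_facts.

(** * Expected number of events that occur *)

Section counting_measure_bounds.
Context d (Y : measurableType d) (R : realType) (mu : probability Y R) (I : finType).
Variable E : I -> set Y.
Hypothesis mE : forall i, measurable (E i).

Lemma sum_measure_integral :
  (\sum_i mu (E i) = \int[mu]_y (\sum_i \1_(E i) y)%:E)%E.
Proof.
under eq_integral do rewrite -sumEFin.
rewrite ge0_integral_sum//; last first.
  by move=> i; apply/measurable_EFinP; exact: measurable_indic.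
by apply: eq_bigr => i _; rewrite integral_indic// setIT.
Qed.

Let msum : measurable_fun setT (fun y => (\sum_i \1_(E i) y : R)%:E).
Proof.
by apply/measurable_EFinP/measurable_sum => i; exact: measurable_indic.
Qed.

Lemma sum_measure_le (c : R) : (forall y, \sum_i \1_(E i) y <= c) ->
  (\sum_i mu (E i) <= c%:E)%E.
Proof.
move=> Ec; have c0 : 0 <= c by apply: le_trans (Ec point); exact: sumr_ge0.
rewrite sum_measure_integral -[leRHS]mule1 -(@probability_setT _ _ _ mu).
rewrite -integral_cst//; apply: ge0_le_integral => //.
  by move=> y _; rewrite lee_fin; exact: sumr_ge0.
by move=> y _; rewrite lee_fin.
Qed.

Lemma sum_measure_ge (c : R) F : measurable F -> 0 <= c ->
  (forall y, F y -> c <= \sum_i \1_(E i) y) ->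
  (c%:E * mu F <= \sum_i mu (E i))%E.
Proof.
move=> mF c0 cE; rewrite sum_measure_integral -[F]setIT -integral_indic//.
rewrite -ge0_integralZl//; last first.
  by apply/measurable_EFinP; exact: measurable_indic.
apply: ge0_le_integral => //.
- by move=> y _; rewrite -EFinM lee_fin mulr_ge0.
- apply/measurable_EFinP/measurable_funM => //; exact: measurable_indic.
move=> y _; rewrite -EFinM lee_fin indicE; case: (boolP (y \in F)) => yF.
  by rewrite mulr1; apply: cE; rewrite inE in yF.
by rewrite mulr0; exact: sumr_ge0.
Qed.

End counting_measure_bounds.

(** * Block parameters and decoding errors *)

Section block_parameters.
Context {R : realType} (p m N : nat) (i0 : 'I_p) (idx : 'I_m -> 'I_N -> 'I_p).
Hypothesis idx_inj :
  forall b j b' j', idx b j = idx b' j' -> b = b' /\ j = j'.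
Hypothesis idx_i0 : forall b j, idx b j != i0.
Variables (t delta : R).
Implicit Types (J : {ffun 'I_m -> 'I_N}).

Definition block_param J : 'cV[R]_p :=
  t *: delta_mx i0 0 + \sum_b delta *: delta_mx (idx b (J b)) 0.

(** With block b left empty, the law of this parameter is a common reference for all N positions in
    block b. *)
Definition block_hole J (b : 'I_m) : 'cV[R]_p :=
  t *: delta_mx i0 0 + \sum_(b' | b' != b) delta *: delta_mx (idx b' (J b')) 0.

Definition update J b j : {ffun 'I_m -> 'I_N} :=
  [ffun b' => if b' == b then j else J b'].

Lemma updateK J b j : update (update J b j) b (J b) = J.
Proof. by apply/ffunP => b'; rewrite !ffunE; case: eqVneq => [->|]. Qed.

Lemma update_id J b j : update J b j b = j.
Proof. by rewrite ffunE eqxx. Qed.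

Lemma block_paramE J b :
  block_param J = block_hole J b + delta *: delta_mx (idx b (J b)) 0.
Proof. by rewrite /block_param (bigD1 b)//= [X in _ + X]addrC addrA. Qed.

Lemma block_hole_update J b j : block_hole (update J b j) b = block_hole J b.
Proof.
congr (_ + _); apply: eq_bigr => b' b'b.
by rewrite ffunE (negbTE b'b).
Qed.

Lemma block_sum_coord (Q : pred 'I_m) J i :
  (\sum_(b | Q b) delta *: delta_mx (idx b (J b)) 0 : 'cV[R]_p) i 0 =
  \sum_(b | Q b) delta * (i == idx b (J b))%:R.
Proof. by rewrite summxE; apply: eq_bigr => b _; rewrite !mxE eqxx andbT. Qed.

Lemma block_hole_i0 J b : block_hole J b i0 0 = t.
Proof.
rewrite mxE block_sum_coord !mxE !eqxx mulr1 big1 ?addr0// => b' _.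
by rewrite eq_sym (negbTE (idx_i0 _ _)) mulr0.
Qed.

Lemma block_param_i0 J : block_param J i0 0 = t.
Proof.
rewrite mxE block_sum_coord !mxE !eqxx mulr1 big1 ?addr0// => b' _.
by rewrite eq_sym (negbTE (idx_i0 _ _)) mulr0.
Qed.

Lemma block_param_idx J b j : block_param J (idx b j) 0 = delta * (j == J b)%:R.
Proof.
rewrite mxE block_sum_coord !mxE (negbTE (idx_i0 _ _)) mulr0 add0r.
rewrite (bigD1 b)//= big1 ?addr0.
  congr (_ * _%:R); congr nat_of_bool; apply/eqP/eqP => [/idx_inj[]//|->//].
move=> b' b'b; case: eqP => [/idx_inj[/esym/eqP]|]; last by rewrite mulr0.
by rewrite (negbTE b'b).
Qed.

Lemma block_param_sqr J : \sum_i block_param J i 0 ^+ 2 = t ^+ 2 + m%:R * delta ^+ 2.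
Proof.
transitivity (\sum_i (t * (i == i0)%:R * block_param J i 0 +
    \sum_b delta * (i == idx b (J b))%:R * block_param J i 0)).
  apply: eq_bigr => i _; rewrite expr2 {1}/block_param mxE block_sum_coord.
  by rewrite !mxE eqxx andbT mulrDl mulr_suml.
rewrite big_split/= exchange_big/=; congr (_ + _).
  rewrite (bigD1 i0)//= big1 ?addr0 => [|i ii0].
    by rewrite eqxx mulr1 block_param_i0.
  by rewrite (negbTE ii0) mulr0 mul0r.
transitivity (\sum_(b < m) delta ^+ 2); last by rewrite sumr_const card_ord mulr_natl.
apply: eq_bigr => b _; rewrite (bigD1 (idx b (J b)))//= big1 ?addr0 => [|i ib].
  by rewrite eqxx mulr1 block_param_idx eqxx mulr1.
by rewrite (negbTE ib) mulr0 mul0r.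
Qed.

Lemma block_param_l0 J : (l0_norm (block_param J) <= m.+1)%N.
Proof.
apply: (@leq_trans #|i0 |: [set idx b (J b) | b : 'I_m]|)%SET.
  apply/subset_leq_card/fintype.subsetP => i; rewrite !inE; apply: contraR.
  rewrite negb_or => /andP[ii0 iJ].
  rewrite mxE block_sum_coord !mxE (negbTE ii0) mulr0 add0r big1// => b _.
  case: eqP => [iE|]; last by rewrite mulr0.
  by move: iJ; rewrite iE imset_f.
rewrite cardsU1 -add1n leq_add ?leq_b1//.
by rewrite (leq_trans (leq_imset_card _ _))// card_ord.
Qed.

Section estimation.
Context d (Y : measurableType d) (law : 'cV[R]_p -> probability Y R).
Variables (T : Y -> 'cV[R]_p) (a : R).
Hypothesis mT : measurable_fun setT T.
Hypotheses (N0 : (0 < N)%N) (m0 : (0 < m)%N) (delta0 : 0 <= delta).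
Hypothesis aN : a <= 5 / 7 * N%:R.
Hypothesis law_le : forall J b kappa E, 0 < kappa -> measurable E ->
  (law (block_param J) E <= (a / (2 * kappa))%:E + (kappa / 2)%:E * law (block_hole J b) E)%E.

(** Uniqueness of the large coordinate makes these events disjoint in [j]; missing the true position
    costs an error of at least delta / 2 in some coordinate of the block. *)
Definition decoded b j : set Y :=
  [set y | delta / 2 <= T y (idx b j) 0 /\
           forall j', j' != j -> T y (idx b j') 0 < delta / 2].

Lemma measurable_decoded b j : measurable (decoded b j).
Proof.
have mTi i : measurable_fun setT (fun y => T y i 0).
  exact: (measurableT_comp (measurable_coord i 0) mT).
rewrite (_ : decoded b j = (fun y => T y (idx b j) 0) @^-1` `[delta / 2, +oo[ `&`
    \bigcap_(j' in [set j' | j' != j]) ((fun y => T y (idx b j') 0) @^-1`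
      `]-oo, delta / 2[)).
  apply: measurableI; first exact: measurable_preim.
  apply: fin_bigcap_measurable => [|j' _]; first exact: finite_finset.
  exact: measurable_preim.
apply/seteqP; split=> y /=.
  by move=> [Ty yT]; split; rewrite /= ?in_itv/= ?andbT// => j' /yT; rewrite /= in_itv.
by move=> [+ yT]; rewrite in_itv/= andbT => Ty; split=> // j' /yT.
Qed.

Lemma decoded_disjoint b j j' y : decoded b j y -> decoded b j' y -> j = j'.
Proof.
move=> [yj _] [_ yj']; apply/eqP; apply: contraT => jj'.
by have := yj' _ jj'; rewrite ltNge yj.
Qed.

Lemma sum_decoded_le b (mu : probability Y R) : (\sum_j mu (decoded b j) <= 1)%E.
Proof.
apply: sum_measure_le => [j|y]; first exact: measurable_decoded.
have [[j yj]|no] := pselect (exists j, decoded b j y).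
  rewrite (bigD1 j)//= big1 ?addr0 => [|j' j'j]; first by rewrite indicE lern1 leq_b1.
  rewrite indicE memNset// => yj'; move: j'j.
  by rewrite (decoded_disjoint yj yj') eqxx.
rewrite big1// => j _; rewrite indicE memNset// => yj; apply: no; by exists j.
Qed.

Let pr J b := fine (law (block_param J) (decoded b (J b))).

Let prE J b : (pr J b)%:E = law (block_param J) (decoded b (J b)).
Proof. by rewrite fineK// fin_num_measure//; exact: measurable_decoded. Qed.

(** All N laws are compared with the same [block_hole] law, under which the probabilities of the
    disjoint decoding events sum to at most 1; so the second terms contribute at most kappa / 2 in
    total. *)
Lemma block_success_le J b : \sum_j pr (update J b j) b <= 17 / 20 * N%:R.
Proof.
have N0' : 0 < N%:R :> R by rewrite ltr0n.
(* This kappa bounds the sum by (3 / 7 + 5 / 12) N <= 17 / 20 N. *)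
pose kappa : R := 5 / 6 * N%:R.
have k0 : 0 < kappa by rewrite mulr_gt0.
rewrite -lee_fin -sumEFin.
apply: (@le_trans _ _ (\sum_(j < N) ((a / (2 * kappa))%:E +
    (kappa / 2)%:E * law (block_hole J b) (decoded b j)))%E).
  apply: lee_sum => j _; rewrite prE -(block_hole_update J b j) update_id.
  by apply: law_le => //; exact: measurable_decoded.
rewrite big_split/= -ge0_sume_distrr; last by move=> j _; exact: measure_ge0.
rewrite sumEFin sumr_const card_ord.
apply: (@le_trans _ _ ((a / (2 * kappa) *+ N)%:E + (kappa / 2)%:E * 1)%E).
  rewrite leeD2l// lee_wpmul2l ?sum_decoded_le// lee_fin divr_ge0// ltW//.
rewrite mule1 -EFinD lee_fin -mulr_natr.
rewrite (_ : a / (2 * kappa) * N%:R = 3 / 5 * a); last first.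
  by rewrite /kappa; field; rewrite gt_eqF.
have main (x : R) : a <= 5 / 7 * x -> 0 < x ->
    3 / 5 * a + 5 / 6 * x / 2 <= 17 / 20 * x by lra.
exact: main.
Qed.

(** (J, j) |-> (update J b j, J b) is an involution, so resampling one block preserves the uniform
    average over configurations. *)
Lemma sum_update (F : {ffun 'I_m -> 'I_N} -> R) b :
  \sum_J \sum_j F (update J b j) = N%:R * \sum_J F J.
Proof.
rewrite pair_bigA/=.
pose h (x : {ffun 'I_m -> 'I_N} * 'I_N) := (update x.1 b x.2, x.1 b).
have hK : involutive h by move=> [J j]; rewrite /h/= updateK update_id.
rewrite (reindex_inj (inv_inj hK))/=.
transitivity (\sum_(x : {ffun 'I_m -> 'I_N} * 'I_N) F x.1).
  by apply: eq_bigr => -[J j] _ /=; rewrite updateK.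
rewrite -(pair_bigA _ (fun J _ => F J))/= mulr_sumr.
by apply: eq_bigr => J _; rewrite sumr_const card_ord mulr_natl.
Qed.

(** Averaging argument: [sum_update] and [block_success_le] bound the mean of the sum over all J,
    hence its value at some J. *)
Lemma exists_block_success_le : exists J, \sum_b pr J b <= 17 / 20 * m%:R.
Proof.
apply: contrapT => noJ.
have N0' : 0 < N%:R :> R by rewrite ltr0n.
have lt_J J : 17 / 20 * m%:R < \sum_b pr J b.
  by rewrite ltNge; apply/negP => h; apply: noJ; exists J.
have : \sum_(J : {ffun 'I_m -> 'I_N}) 17 / 20 * m%:R < \sum_J \sum_b pr J b.
  have J0 : {ffun 'I_m -> 'I_N} := [ffun=> Ordinal N0].
  apply: ltr_sum => //; apply/hasP; exists J0 => //; exact: mem_index_enum.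
rewrite exchange_big/= -(ltr_pM2l N0') [ltRHS]mulr_sumr.
under [ltRHS]eq_bigr => b _ do rewrite -(sum_update (pr ^~ b) b).
apply/negP; rewrite -leNgt.
apply: (@le_trans _ _ (\sum_(b < m) \sum_(J : {ffun 'I_m -> 'I_N}) 17 / 20 * N%:R)).
  by apply: ler_sum => b _; apply: ler_sum => J _; exact: block_success_le.
have natE (x : R) k : x *+ k = x * k%:R by rewrite mulr_natr.
rewrite !sumr_const card_ord [leLHS]natE [X in X * _ <= _]natE [X in _ <= _ * X]natE.
by rewrite le_eqVlt; apply/orP; left; apply/eqP; ring.
Qed.

Lemma undecoded_error J b y : ~ decoded b (J b) y ->
  exists j, delta / 2 <= `|(T y - block_param J) (idx b j) 0|.
Proof.
move=> nd; have [Ty|Ty] := ltP (T y (idx b (J b)) 0) (delta / 2).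
  exists (J b); rewrite mxE [X in _ + X]mxE block_param_idx eqxx mulr1.
  by rewrite distrC ler_normr; apply/orP; left; lra.
have [j [jJ Tj]] : exists j, j != J b /\ delta / 2 <= T y (idx b j) 0.
  apply: contrapT => no; apply: nd; split=> // j jJ; rewrite ltNge.
  by apply/negP => Tj; apply: no; exists j.
exists j; rewrite mxE [X in _ + X]mxE block_param_idx (negbTE jJ) mulr0 subr0.
by rewrite ler_normr Tj.
Qed.

(** Markov's inequality: off the error event [F] fewer than m / 20 blocks are undecoded, so at least
    19 m / 20 succeed, whereas the expected number of successes is at most 17 m / 20 for the chosen
    [J]. *)
Theorem block_lower_bound (q : \bar R) (thr : R) : (1 <= q)%E ->
  thr <= (m%:R / 20) `^ inv_exponent q * (delta / 2) ->
  exists J, (10^-1%:E <= law (block_param J)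
    [set y | (thr <= lq_norm q (T y - block_param J))%R])%E.
Proof.
move=> q1 thrE; have [J hJ] := exists_block_success_le; exists J.
set mu := law (block_param J); set F := [set y | _].
have m0' : 0 < m%:R :> R by rewrite ltr0n.
have mF : measurable F.
  rewrite (_ : F = (fun y => lq_norm q (T y - block_param J)) @^-1` `[thr, +oo[).
    apply: measurable_preim => //.
    apply: (measurableT_comp (measurable_lq_norm q)).
    apply/measurable_fun_mxP => i j.
    rewrite (_ : (fun _ => _) = (fun y => T y i j - block_param J i j)).
      apply: measurable_funB => //.
      exact: (measurableT_comp (measurable_coord i j) mT).
    by apply/funext => y; rewrite !mxE.
  by apply/seteqP; split=> y /=; rewrite in_itv/= andbT.
have h : ((19 / 20 * m%:R)%:E * mu (~` F) <= \sum_b mu (decoded b (J b)))%E.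
  apply: sum_measure_ge.
  - by move=> b; exact: measurable_decoded.
  - exact: measurableC.
  - by rewrite mulr_ge0.
  move=> y nF; rewrite leNgt; apply/negP => lt19; apply: nF; rewrite /F/=.
  pose bad := [set b | `[< ~ decoded b (J b) y >]]%SET.
  have badE : (#|bad|%:R : R) = m%:R - \sum_b \1_(decoded b (J b)) y.
    have -> : m%:R = \sum_(b < m) (1 : R) by rewrite sumr_const card_ord.
    rewrite -sumrB -sum1_card natr_sum big_mkcond/=; apply: eq_bigr => b _.
    rewrite inE indicE; case: asboolP => [nd|nd].
      by rewrite memNset// subr0.
    by rewrite mem_set ?subrr//; exact: contrapT.
  have bad20 : m%:R / 20 <= #|bad|%:R :> R by rewrite badE; lra.
  have bad0 : (0 < #|bad|)%N.
    by rewrite -(ltr0n R); apply: lt_le_trans bad20; rewrite divr_gt0.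
  have /choice[f Hf] : forall b, exists j, ~ decoded b (J b) y ->
      delta / 2 <= `|(T y - block_param J) (idx b j) 0|.
    move=> b; have [/undecoded_error[j Hj]|nd] := pselect (~ decoded b (J b) y).
      by exists j.
    by exists (J b).
  pose I := [set idx b (f b) | b in bad]%SET.
  have cI : #|I| = #|bad|.
    by rewrite card_in_imset// => b b' _ _ /idx_inj[].
  apply: (le_trans thrE); apply: (@le_trans _ _ (#|I|%:R `^ inv_exponent q * (delta / 2))).
    rewrite cI ler_wpM2r ?divr_ge0//; apply: ler_powR2r => //.
    case: q q1 {mF F thrE} => [r| |]//= r1.
    by rewrite invr_ge0 (le_trans ler01)// -lee_fin.
  apply: lq_norm_ge => //; first by rewrite divr_ge0.
    by rewrite cI.
  by move=> i /imsetP[b]; rewrite inE => /asboolP bb ->; exact: Hf.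
have : (\sum_b mu (decoded b (J b)) <= (17 / 20 * m%:R)%:E)%E.
  by under eq_bigr do rewrite -prE; rewrite sumEFin lee_fin.
move=> /(le_trans h); rewrite probability_setC//.
have <- : (fine (mu F))%:E = mu F by rewrite fineK// fin_num_measure.
rewrite -EFinB -EFinM !lee_fin; set x := fine _ => hx.
(* Division by m leaves x >= 2/19, which exceeds 1/10. *)
have : 19 / 20 * (1 - x) <= 17 / 20.
  by rewrite -(ler_pM2r m0') mulrAC.
lra.
Qed.

End estimation.
End block_parameters.

(** * The lower bound *)

Lemma observation_measurable (R : realType) (n p : nat) d
    (Omega : measurableType d) (P : probability Omega R)
    (xi : {RV P >-> 'cV[R]_n}) (X W : {RV P >-> 'M[R]_(n, p)}) theta :
  measurable_fun setT (observation xi X W theta).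
Proof.
have mX i j : measurable_fun setT (fun w => X w i j).
  exact: (measurableT_comp (measurable_coord i j)).
apply: measurable_fun_pair; apply/measurable_fun_mxP => i j.
- rewrite (_ : (fun _ => _) = (fun w => \sum_l X w i l * theta l j + xi w i j)).
    apply: measurable_funD; last exact: (measurableT_comp (measurable_coord i j)).
    by apply: measurable_sum => l; exact: measurable_funM.
  by apply/funext => w; rewrite !mxE.
- rewrite (_ : (fun _ => _) = (fun w => X w i j + W w i j)).
    by apply: measurable_funD => //; exact: (measurableT_comp (measurable_coord i j)).
  by apply/funext => w; rewrite !mxE.
Qed.

(** One coordinate carries t e_0, leaving p - 1 for the blocks. Taking m <= (p - 1) / 2 gives N >=
    2, and m <= s - 1 leaves room in the support for e_0. The last bound serves to dominate log(p/s)
    by 2 log N. *)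
Lemma block_dimensions (p s : nat) : (2 <= s < p)%N ->
  exists m N : nat,
    [/\ (0 < m)%N, (2 <= N)%N, (m * N < p)%N, (m < s)%N & (s <= 4 * m)%N]
    /\ (p <= s * N ^ 2)%N.
Proof.
move=> /andP[s2 sp]; exists (minn s.-1 p.-1./2), (p.-1 %/ minn s.-1 p.-1./2)%N.
set m := minn _ _; set N := (p.-1 %/ m)%N.
have hp : p.-1 = (odd p.-1 + p.-1./2 * 2)%N by rewrite muln2 odd_double_half.
have odd1 : (odd p.-1 <= 1)%N by rewrite leq_b1.
have mE : (m = s.-1 /\ s.-1 <= p.-1./2 \/ m = p.-1./2 /\ p.-1./2 < s.-1)%N.
  by rewrite /m; lia.
have m0 : (0 < m)%N by lia.
have m2 : (m * 2 <= p.-1)%N by lia.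
have N2 : (2 <= N)%N by rewrite /N leq_divRL// mulnC.
have mN : (m * N <= p.-1)%N by rewrite mulnC leq_divM.
have Np : (p.-1 < N.+1 * m)%N by rewrite ltn_ceil.
clearbody m N; split; first by split; lia.
have NN : (N.+1 <= N ^ 2)%N by nia.
(* Here p <= (N + 1) m. If m = s - 1, this is at most s N^2; otherwise p <= 4 s <= s N^2. *)
case: mE => [[mE _]|[mE h]].
  have : (N.+1 * s.-1 <= s * N ^ 2)%N by rewrite mulnC leq_mul// leq_pred.
  by rewrite -mE; lia.
have : (s * 4 <= s * N ^ 2)%N by rewrite leq_mul2l; nia.
by lia.
Qed.

Lemma ln_le_double (R : realType) (p s N : nat) : (0 < s)%N -> (0 < N)%N ->
  (p <= s * N ^ 2)%N -> (0 < p)%N -> ln (p%:R / s%:R) <= 2 * ln N%:R :> R.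
Proof.
move=> s0 N0 ps p0.
have s0' : 0 < s%:R :> R by rewrite ltr0n.
have N0' : 0 < N%:R :> R by rewrite ltr0n.
rewrite (_ : 2 * ln N%:R = ln (N%:R ^+ 2)); last by rewrite lnXn// mulr_natl.
rewrite ler_ln ?posrE ?divr_gt0 ?exprn_gt0 ?ltr0n//.
by rewrite ler_pdivrMr// mulrC -natrX -natrM ler_nat.
Qed.

(** exp (2 x) <= sqrt N, and sqrt N <= (5 / 7) N for N >= 2 because (7 / 5)^2 = 49 / 25 < 2. *)
Lemma expR_half_ln_le (R : realType) (N : nat) (x : R) : (2 <= N)%N ->
  4 * x <= ln N%:R -> expR (2 * x) <= 5 / 7 * N%:R.
Proof.
move=> N2 xN; have N0 : 0 < N%:R :> R by rewrite ltr0n (leq_trans _ N2).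
have e0 := expR_gt0 (2 * x).
have e2 : expR (2 * x) ^+ 2 <= N%:R.
  rewrite -expRM_natl -[leRHS](@lnK _ N%:R) ?posrE// ler_expR.
  by rewrite mulrA (_ : 2%:R * 2 = 4) //; ring.
have N2' : 2 <= N%:R :> R by rewrite (ler_nat _ 2).
rewrite -(@ler_pXn2r _ 2) ?nnegrE ?(ltW e0) ?mulr_ge0//.
by apply: le_trans e2 _; nra.
Qed.

(** As 0 <= 1/q <= 1 and m / 20 >= s / 80, the power is at least s^(1/q) / 80, with a constant free
    of q; 160 is 2 * 80. *)
Lemma lower_bound_threshold (R : realType) (q : \bar R) (a delta1 : R) (s m : nat) :
  (1 <= q)%E -> 0 <= a -> 0 <= delta1 -> (s <= 4 * m)%N ->
  a / 160 * s%:R `^ inv_exponent q * delta1 <=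
  (m%:R / 20) `^ inv_exponent q * (a * delta1 / 2).
Proof.
move=> q1 a0 d0 sm; set e := inv_exponent q.
have /andP[e0 e1] : 0 <= e <= 1.
  rewrite /e; case: q q1 {e} => [r| |]//= q1; last by rewrite lexx ler01.
  have r1 : 1 <= r by rewrite -lee_fin.
  by rewrite invr_ge0 (le_trans ler01)//= invf_le1// (lt_le_trans ltr01).
have h : s%:R `^ e / 80 <= (m%:R / 20) `^ e :> R.
  apply: (@le_trans _ _ ((s%:R / 80) `^ e)).
    rewrite powRM ?invr_ge0// ler_wpM2l ?powR_ge0//.
    by apply: ger1_powR => //; lra.
  apply: ler_powR2r => //.
  rewrite ler_pdivrMr// -mulrA mulrC (_ : 20^-1 * 80 = 4 :> R); last by field.
  by rewrite -(natrM _ 4) ler_nat.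
rewrite (_ : _ * _ = s%:R `^ e / 80 * (a * delta1 / 2)); last by field.
by rewrite ler_wpM2r// divr_ge0// mulr_ge0.
Qed.

(** For r <= 1 the whole shift is put on xi, and (r + 1)^2 <= 4; for r > 1 it is put on X and W, and
    (r + 1)^2 / t^2 <= 4 r^2 / (r^2 / 2) = 8. *)
Lemma shift_factor_le (R : realType) (r t g h : R) :
  0 < r -> r ^+ 2 / 2 <= t ^+ 2 -> 0 <= g -> 0 <= h ->
  exists g1 g2 : R, g1 + g2 * t = 1 /\
    (g1 ^+ 2 * g + g2 ^+ 2 * h) * (r + 1) ^+ 2 <= 4 * g + 8 * h.
Proof.
move=> r0 rt g0 h0; have [r1|r1] := leP r 1.
  exists 1, 0; split; first by rewrite mul0r addr0.
  rewrite expr1n mul1r expr0n mul0r addr0.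
  have h1 : (r + 1) ^+ 2 <= 4 by nra.
  apply: (@le_trans _ _ (g * 4)); first by rewrite ler_wpM2l.
  by rewrite mulrC lerDl mulr_ge0.
have r2 : 0 < r ^+ 2 by rewrite exprn_gt0.
have t2 : 0 < t ^+ 2 by apply: lt_le_trans rt; rewrite divr_gt0.
have t0 : t != 0 by apply: contraTneq t2 => ->; rewrite expr0n ltxx.
exists 0, t^-1; split; first by rewrite mulVf// add0r.
rewrite expr0n mul0r add0r exprVn.
have h8 : (r + 1) ^+ 2 / t ^+ 2 <= 8 by rewrite ler_pdivrMr//; nra.
rewrite (_ : _ * _ = h * ((r + 1) ^+ 2 / t ^+ 2)); last by ring.
by have := ler_wpM2l h0 h8; lra.
Qed.

Section model.
Context {R : realType} (n p : nat) (sigma sigmas lmin lmax : R) (Sigma : 'M[R]_p).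
Context d (Omega : measurableType d) (P : probability Omega R).
Variables (xi : {RV P >-> 'cV[R]_n}) (X W : {RV P >-> 'M[R]_(n, p)}).

Lemma observation_lawT theta :
  observation_law P xi X W theta setT = 1%E.
Proof. by rewrite /observation_law /pushforward preimage_setT probability_setT. Qed.

(** [observation_law] is a bare set function; measurability of the observation makes it a
    probability, as the block argument requires. *)
Lemma observation_probability :
  exists law : 'cV[R]_p -> probability ('cV[R]_n * 'M[R]_(n, p))%type R,
    forall theta E, law theta E = observation_law P xi X W theta E.
Proof.
suff /choice[law lawE] : forall theta,
    exists law : probability ('cV[R]_n * 'M[R]_(n, p))%type R,
      forall E, law E = observation_law P xi X W theta E by exists law.
move=> theta; have mo := observation_measurable xi X W theta.
pose obs : {RV P >-> ('cV[R]_n * 'M[R]_(n, p))%type} :=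
  HB.pack (observation xi X W theta) (isMeasurableFun.Build _ _ _ _ _ mo).
by exists (distribution P obs).
Qed.

(** Case s = p: log(p/s) = 0, so the threshold is 0 and the event is the whole space. The witness r
    e_0 is a block parameter with no blocks. *)
Lemma dense_lower_bound (r : R) (T : 'cV[R]_n * 'M[R]_(n, p) -> 'cV[R]_p) q :
  (0 < p)%N -> 0 < r ->
  exists2 theta, (sparse_ball p `&` l2_sphere r) theta &
    (10^-1%:E <= observation_law P xi X W theta
      [set yZ | (0 <= lq_norm q (T yZ - theta))%R])%E.
Proof.
move=> p0 r0; pose i0 := Ordinal p0.
pose idx (b : 'I_0) (j : 'I_1) := i0.
exists (block_param i0 idx r 0 [ffun=> ord0]).
  split; first by rewrite /sparse_ball/= (leq_trans (max_card _))// card_ord.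
  apply: (etrans (lq_norm2 _)); rewrite block_param_sqr; [|by case|by case].
  by rewrite mul0r addr0 sqrtr_sqr gtr0_norm.
rewrite (_ : [set yZ | _] = setT) ?observation_lawT ?lee_fin; first by lra.
by apply/seteqP; split=> // yZ _ /=; exact: lq_norm_ge0.
Qed.

Hypotheses (sigma0 : 0 < sigma) (sigmas0 : 0 < sigmas).
Hypotheses (lmin0 : 0 < lmin) (lmax0 : 0 < lmax).
Hypothesis pdS : positive_definite Sigma.
Hypothesis Smin : smallest_eigenvalue Sigma lmin.
Hypothesis Smax : largest_eigenvalue Sigma lmax.
Hypothesis model : errors_in_variables P sigma sigmas Sigma xi X W.

(** The three conditions on [a] yield, in order, m delta^2 <= r^2 / 2, 4 n v <= log N and v <=
    1/4. *)
Lemma sparse_lower_bound (q : \bar R) (cbar a K r : R) (s : nat)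
    (T : 'cV[R]_n * 'M[R]_(n, p) -> 'cV[R]_p) :
  (1 <= q)%E -> (0 < n)%N -> (2 <= s < p)%N -> 0 < r -> 0 < a -> 0 < cbar ->
  K = 4 * sigma^-1 ^+ 2 + 8 * (lmin^-1 + sigmas^-1 ^+ 2) ->
  a ^+ 2 * (4 * cbar) <= 1 -> a ^+ 2 * (8 * K * lmax) <= 1 ->
  a ^+ 2 * (4 * K * lmax * cbar) <= 1 ->
  s%:R * ln (p%:R / s%:R) / n%:R <= cbar * (r ^+ 2 / (r ^+ 2 + 1)) ->
  measurable_fun setT T ->
  exists2 theta, (sparse_ball s `&` l2_sphere r) theta &
    (10^-1%:E <= observation_law P xi X W theta
      [set yZ | (a / 160 * s%:R `^ inv_exponent q *
          Num.sqrt (ln (p%:R / s%:R) / n%:R) * (r + 1)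
          <= lq_norm q (T yZ - theta))%R])%E.
Proof.
move=> q1 n0 /[dup] sp /block_dimensions[m [N [[m0 N2 mNp ms s4m] psN]]].
move=> r0 a0 c0 KE ac aK aKc hcond mT.
have N0 : (0 < N)%N by exact: leq_trans N2.
have p0 : (0 < p)%N by case: (p) sp => [|//]; rewrite andbC.
have s0 : (0 < s)%N by case: (s) sp.
have n0' : 0 < n%:R :> R by rewrite ltr0n.
have s1' : 1 <= s%:R :> R by rewrite (ler_nat _ 1).
have idx_proof (b : 'I_m) (j : 'I_N) : (1 + (b * N + j) < p)%N.
  rewrite add1n; apply: leq_ltn_trans mNp; apply: (@leq_trans (b.+1 * N)).
    by rewrite mulSn addnC ltn_add2r.
  by rewrite leq_mul2r ltn_ord orbT.
(* Coordinate 0 is kept for [i0]; block b occupies the N coordinates from 1 + b N on. *)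
pose i0 : 'I_p := Ordinal p0.
pose idx b j : 'I_p := Ordinal (idx_proof b j).
have idx_inj b j b' j' : idx b j = idx b' j' -> b = b' /\ j = j'.
  move=> /(congr1 val)/= /eqP; rewrite eqn_add2l => /eqP E.
  have bb' : b = b'.
    apply/val_inj => /=; have := congr1 (divn^~ N) E.
    by rewrite !divnMDl// !divn_small ?addn0 ?ltn_ord.
  split=> //; apply/val_inj/eqP => /=; move/eqP: E; by rewrite bb' eqn_add2l.
have idx_i0 b j : idx b j != i0 by [].
set Q := ln (p%:R / s%:R) / n%:R.
have Q0 : 0 <= Q.
  rewrite divr_ge0// ln_ge0// ler_pdivlMr ?ltr0n// mul1r ler_nat.
  by case/andP: sp => _ /ltnW.
have QE : Q * n%:R = ln (p%:R / s%:R) by rewrite divfK ?gt_eqF.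
have sQ : s%:R * Q <= cbar * (r ^+ 2 / (r ^+ 2 + 1)) by rewrite /Q mulrA.
clearbody Q.
set rate := Num.sqrt Q; have rate0 : 0 <= rate by exact: sqrtr_ge0.
have rate2 : rate ^+ 2 = Q by rewrite sqr_sqrtr.
pose delta := a * rate * (r + 1).
have delta0 : 0 <= delta by rewrite !mulr_ge0// ?ltW// addr_gt0.
have delta2 : delta ^+ 2 = a ^+ 2 * Q * (r + 1) ^+ 2 by rewrite !exprMn rate2.
have r21 : 0 < r ^+ 2 + 1 by rewrite ltr_wpDl// sqr_ge0.
have rr1 : r ^+ 2 / (r ^+ 2 + 1) <= 1 by rewrite ler_pdivrMr// mul1r lerDl.
(* By (r + 1)^2 <= 2 (r^2 + 1): the factor r^2 / (r^2 + 1) of the assumption absorbs the (r + 1)^2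
   of delta^2. *)
have rr2 : r ^+ 2 / (r ^+ 2 + 1) * (r + 1) ^+ 2 <= 2 * r ^+ 2.
  rewrite mulrAC ler_pdivrMr// (mulrC 2) -[leRHS]mulrA ler_wpM2l ?sqr_ge0//.
  by have := sqr_ge0 (r - 1); lra.
have mdelta : m%:R * delta ^+ 2 <= r ^+ 2 / 2.
  have msR : m%:R <= s%:R :> R by rewrite ler_nat ltnW.
  apply: (@le_trans _ _ (s%:R * delta ^+ 2)); first by rewrite ler_wpM2r ?sqr_ge0.
  rewrite delta2 (_ : _ * _ = a ^+ 2 * (r + 1) ^+ 2 * (s%:R * Q)); last by ring.
  apply: (@le_trans _ _ (a ^+ 2 * (r + 1) ^+ 2 * (cbar * (r ^+ 2 / (r ^+ 2 + 1))))).
    by rewrite ler_wpM2l// mulr_ge0 ?sqr_ge0.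
  rewrite (_ : _ * _ = a ^+ 2 * cbar * (r ^+ 2 / (r ^+ 2 + 1) * (r + 1) ^+ 2)); last by ring.
  apply: (@le_trans _ _ (a ^+ 2 * cbar * (2 * r ^+ 2))).
    by rewrite ler_wpM2l// mulr_ge0 ?sqr_ge0// ltW.
  have r20 := sqr_ge0 r; move: ac r20; set x := r ^+ 2; set y := a ^+ 2.
  rewrite mulrCA => yc x0; have := ler_wpM2r x0 yc; lra.
(* Chosen so that every block parameter has norm exactly r. *)
pose t := Num.sqrt (r ^+ 2 - m%:R * delta ^+ 2).
have t2 : t ^+ 2 = r ^+ 2 - m%:R * delta ^+ 2.
  by rewrite sqr_sqrtr//; have := sqr_ge0 r; lra.
have ht : r ^+ 2 / 2 <= t ^+ 2 by rewrite t2; lra.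
have g0 : 0 <= sigma^-1 ^+ 2 by exact: sqr_ge0.
have h0 : 0 <= lmin^-1 + sigmas^-1 ^+ 2 by rewrite addr_ge0 ?sqr_ge0// invr_ge0 ltW.
have [g1 [g2 [g12 hg]]] := shift_factor_le r0 ht g0 h0; rewrite -KE in hg.
have K0 : 0 <= K by rewrite KE addr_ge0// mulr_ge0.
(* Free of r: the factor (r + 1)^2 in delta^2 is absorbed by [hg]. *)
pose v := K * a ^+ 2 * Q * lmax.
have v4 : v <= 4^-1.
  have Qc : Q <= cbar.
    apply: (@le_trans _ _ (s%:R * Q)); first by rewrite ler_peMl.
    by apply: le_trans sQ _; rewrite ler_piMr// ltW.
  have : K * a ^+ 2 * lmax * Q <= K * a ^+ 2 * lmax * cbar.
    by rewrite ler_wpM2l// !mulr_ge0 ?sqr_ge0// ltW.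
  by rewrite /v; lra.
have hv : ((g1 / sigma) ^+ 2 + g2 ^+ 2 * (lmin^-1 + sigmas^-1 ^+ 2)) *
    (delta ^+ 2 * lmax) <= v.
  rewrite delta2 exprMn /v.
  rewrite (_ : _ * _ = (g1 ^+ 2 * sigma^-1 ^+ 2 + g2 ^+ 2 * (lmin^-1 + sigmas^-1 ^+ 2)) *
    (r + 1) ^+ 2 * (a ^+ 2 * Q * lmax)); last by ring.
  rewrite (_ : K * _ * _ * _ = K * (a ^+ 2 * Q * lmax)); last by ring.
  have aQ0 : 0 <= a ^+ 2 * Q * lmax by rewrite !mulr_ge0 ?sqr_ge0// ltW.
  exact: ler_wpM2r.
have expN : expR (2 * n%:R * v) <= 5 / 7 * N%:R.
  rewrite -mulrA; apply: expR_half_ln_le => //.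
  have lnN : Q * n%:R <= 2 * ln N%:R.
    by rewrite QE; exact: ln_le_double.
  rewrite /v (_ : _ * _ = 4 * K * a ^+ 2 * lmax * (Q * n%:R)); last by ring.
  apply: (@le_trans _ _ (4 * K * a ^+ 2 * lmax * (2 * ln N%:R))).
    by rewrite ler_wpM2l// !mulr_ge0 ?sqr_ge0// ltW.
  have lnN0 : 0 <= ln N%:R :> R by rewrite ln_ge0// (ler_nat _ 1).
  by have := ler_wpM2r lnN0 aK; lra.
have [law lawE] := observation_probability.
have law_le J b kappa E : 0 < kappa -> measurable E ->
  (law (block_param i0 idx t delta J) E <= (expR (2 * n%:R * v) / (2 * kappa))%:E +
    (kappa / 2)%:E * law (block_hole i0 idx t delta J b) E)%E.
  move=> kap0 mE; rewrite !lawE (block_paramE _ _ _ _ _ b).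
  apply: (observation_law_le (k0 := i0) (g1 := g1) (g2 := g2) sigma0 sigmas0
    pdS Smin Smax model) => //.
  by rewrite block_hole_i0.
have thrE : a / 160 * s%:R `^ inv_exponent q * rate * (r + 1) <=
    (m%:R / 20) `^ inv_exponent q * (delta / 2).
  rewrite -[leLHS]mulrA /delta (_ : a * rate * (r + 1) = a * (rate * (r + 1))).
    apply: lower_bound_threshold => //; first exact: ltW.
    by rewrite mulr_ge0// ltW// addr_gt0.
  by rewrite mulrA.
have [J hJ] := block_lower_bound idx_inj idx_i0 mT N0 m0 delta0 expN
  law_le q1 thrE.
exists (block_param i0 idx t delta J); last by rewrite -lawE.
split; first by rewrite /sparse_ball/= (leq_trans (block_param_l0 _ _ _ _ _)).
apply: (etrans (lq_norm2 _)); rewrite block_param_sqr// t2 subrK sqrtr_sqr.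
by rewrite gtr0_norm.
Qed.

End model.

Theorem theorem3 (R : realType) (q : \bar R)
    (sigma sigmas cbar lmin lmax : R) :
  (1 <= q)%E -> 0 < sigma -> 0 < sigmas -> 0 < cbar ->
  exists c c' : R, [/\ 0 < c, 0 < c' &
    forall (n p s : nat) (r : R) (Sigma : 'M[R]_p),
      (0 < n)%N -> (2 <= p)%N -> (2 <= s <= p)%N -> 0 < r ->
      positive_definite Sigma ->
      smallest_eigenvalue Sigma lmin -> largest_eigenvalue Sigma lmax ->
      s%:R * ln (p%:R / s%:R) / n%:R <= cbar * (r ^+ 2 / (r ^+ 2 + 1)) ->
    forall (d : measure_display) (Omega : measurableType d)
      (P : probability Omega R)
      (xi : {RV P >-> 'cV[R]_n}) (X W : {RV P >-> 'M[R]_(n, p)}),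
      errors_in_variables P sigma sigmas Sigma xi X W ->
      (c'%:E <
       ereal_inf [set ereal_sup
         [set observation_law P xi X W theta
            [set yZ | (c * s%:R `^ inv_exponent q *
                       Num.sqrt (ln (p%:R / s%:R) / n%:R) * (r + 1)
                       <= lq_norm q (T yZ - theta))%R]
         | theta in sparse_ball s `&` l2_sphere r]
       | T in estimators n p])%E].
Proof.
move=> q1 sigma0 sigmas0 c0.
have [lmin0|lmin_le0] := ltP 0 lmin; last first.
  (* A positive definite matrix has a positive smallest eigenvalue, so the claim is vacuous here. *)
  exists 1, 1; split=> // n p s r Sigma _ _ _ _ pdS Smin.
  by have := smallest_eigenvalue_gt0 pdS Smin; rewrite ltNge lmin_le0.
have [lmax0|lmax_le0] := ltP 0 lmax; last first.
  exists 1, 1; split=> // n p s r Sigma _ _ _ _ _ [emin _] [_ /(_ _ emin)].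
  by rewrite leNgt (le_lt_trans lmax_le0).
pose K := 4 * sigma^-1 ^+ 2 + 8 * (lmin^-1 + sigmas^-1 ^+ 2).
have h0 : 0 <= lmin^-1 + sigmas^-1 ^+ 2 by rewrite addr_ge0 ?sqr_ge0// invr_ge0 ltW.
have K0 : 0 <= K by rewrite addr_ge0// mulr_ge0// sqr_ge0.
have KL0 : 0 <= K * lmax by rewrite mulr_ge0// ltW.
have KLc0 : 0 <= K * lmax * cbar by rewrite mulr_ge0// ltW.
(* D dominates 1 and the three quantities to be controlled, so a = 1 / D gives a^2 x <= a x <= 1 for
   each of them. *)
pose D := 1 + 4 * cbar + 8 * K * lmax + 4 * K * lmax * cbar.
have D1 : 1 <= D by rewrite /D; lra.
have D0 : 0 < D by exact: lt_le_trans D1.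
pose a := D^-1; have a0 : 0 < a by rewrite invr_gt0.
have aX x : 0 <= x -> x <= D -> a ^+ 2 * x <= 1.
  move=> x0 xD; apply: (@le_trans _ _ (a * x)).
    by rewrite ler_wpM2r// expr2 ler_piMl ?(ltW a0)// invf_le1.
  by rewrite mulrC ler_pdivrMr// mul1r.
exists (a / 160), 20^-1; split; [by rewrite divr_gt0|by rewrite invr_gt0|].
move=> n p s r Sigma n0 p2 /andP[s2 sp] r0 pdS Smin Smax hcond d Omega P xi X W model.
(* The gap between 1/20 and 1/10 keeps the inequality strict after the infimum. *)
apply: (@lt_le_trans _ _ 10^-1%:E); first by rewrite lte_fin; lra.
apply: le_ereal_inf_tmp => _ [T mT <-].
suff [theta theta_in le10] : exists2 theta, (sparse_ball s `&` l2_sphere r) theta &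
    (10^-1%:E <= observation_law P xi X W theta
      [set yZ | (a / 160 * s%:R `^ inv_exponent q *
          Num.sqrt (ln (p%:R / s%:R) / n%:R) * (r + 1)
          <= lq_norm q (T yZ - theta))%R])%E.
  by apply: le_trans le10 _; apply: ereal_sup_ubound; exists theta.
move: sp; rewrite leq_eqVlt => /orP[/eqP sp|sp].
  have p0 : (0 < p)%N by exact: leq_trans p2.
  rewrite sp divff ?pnatr_eq0 -?lt0n// ln1 mul0r sqrtr0 mulr0 mul0r.
  exact: dense_lower_bound.
apply: (@sparse_lower_bound _ _ _ sigma sigmas lmin lmax Sigma _ _ _ _ _ _
  _ _ _ _ _ _ _ _ q cbar a K) => //.
- by rewrite s2.
- by apply: aX; rewrite /D; lra.
- by apply: aX; rewrite /D; lra.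
- by apply: aX; rewrite /D; lra.
Qed.
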